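(* Let $\tau\in\mathbb C$ with $\operatorname{Im}(\tau)>0$, let $g(\tau)$ be the automorphism defined in the context, and let $\mathsf W=\frac{\mathsf U}{2\pi i}+\tau\mathsf V$. Write $g(\tau)(x)^{\rm met-ab}$ for the image of $g(\tau)(x)$ in $\mathfrak p_{\mathbb C}/D^2\mathfrak p_{\mathbb C}=(\mathbb C\mathsf a\oplus\mathbb C\mathsf b)\oplus\mathbb C[[\mathsf U,\mathsf V]]$. Then $$g(\tau)(\mathsf a)^{\rm met-ab}=\mathsf a+2\pi i\tau\,\mathsf b-2\pi i\,\mathsf W\sum_{k=1}^\infty\frac{2}{(2k-2)!}\int_\tau^{\overrightarrow1_\infty}\underline G_{2k}$$ and $$g(\tau)(2\pi i\,\mathsf b)^{\rm met-ab}=2\pi i\,\mathsf b-2\pi i\,\mathsf V\sum_{k=1}^\infty\frac{2}{(2k-2)!}\int_\tau^{\overrightarrow1_\infty}\underline G_{2k},$$ where $\underline G_{2k}=(2\pi i)^{2k-1}G_{2k}(z)(\mathsf W-z\mathsf V)^{2k-2}\,dz$.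
   Context: **Lie algebra.** $\mathfrak p_{\mathbb C}$ is the completion, with respect to the lower central series, of the free Lie algebra over $\mathbb C$ on $\mathsf a,\mathsf b$. $D^1\mathfrak p_{\mathbb C}=[\mathfrak p_{\mathbb C},\mathfrak p_{\mathbb C}]$ and $D^2\mathfrak p_{\mathbb C}=[D^1\mathfrak p_{\mathbb C},D^1\mathfrak p_{\mathbb C}]$ (closed ideals). As a vector space $\mathfrak p_{\mathbb C}/D^2\mathfrak p_{\mathbb C}=(\mathbb C\mathsf a\oplus\mathbb C\mathsf b)\oplus D^1\mathfrak p_{\mathbb C}/D^2\mathfrak p_{\mathbb C}$, and $D^1\mathfrak p_{\mathbb C}/D^2\mathfrak p_{\mathbb C}$ is identified with $\mathbb C[[\mathsf U,\mathsf V]]$ (commuting variables) by $\mathrm{ad}^k(\mathsf a)\mathrm{ad}^l(\mathsf b)([\mathsf a,\mathsf b])\mapsto\mathsf U^k\mathsf V^l$. **Derivations.** For $k\ge0$, $\varepsilon_{2k}$ is the continuous derivation of $\mathfrak p_{\mathbb C}$ with $\varepsilon_0(\mathsf a)=-\mathsf b$, $\varepsilon_0(\mathsf b)=0$, and for $k\ge1$ $$\varepsilon_{2k}(\mathsf a)=\frac{2}{(2k-2)!}\mathrm{ad}^{2k}(\mathsf a)(\mathsf b),\qquad \varepsilon_{2k}(\mathsf b)=\frac{2}{(2k-2)!}\sum_{0\le j<k}(-1)^j[\mathrm{ad}^j(\mathsf a)(\mathsf b),\mathrm{ad}^{2k-1-j}(\mathsf a)(\mathsf b)];$$ one has $\varepsilon_{2k}([\mathsf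 a,\mathsf b])=0$ for all $k\ge 0$. **Eisenstein series and iterated integrals.** $G_0=-1$, and for $k\ge1$, $G_{2k}(\tau)=-\frac{B_{2k}}{4k}+\sum_{n\ge1}\big(\sum_{d\mid n}d^{2k-1}\big)q^n$ with $q=e^{2\pi i\tau}$. The regularized iterated Eisenstein integrals $\mathcal G(2k_1,\dots,2k_n;\tau)=\int_\tau^{\overrightarrow1_\infty}G_{2k_1}(\tau_1)\cdots G_{2k_n}(\tau_n)\,d\tau_1\cdots d\tau_n$ ($k_i\ge0$; tangential base point $1$ at $i\infty$) are the unique functions on the upper half-plane such that $\mathcal G(\emptyset;\tau)=1$ and, for $n\ge1$: $\frac{d}{d\tau}\mathcal G(2k_1,\dots,2k_n;\tau)=-G_{2k_1}(\tau)\,\mathcal G(2k_2,\dots,2k_n;\tau)$, and $\mathcal G(2k_1,\dots,2k_n;\tau)$ is a polynomial in $\tau$ with coefficients convergent power series in $q$ whose $\tau^0q^0$-coefficient is $0$. **The automorphism.** $$g(\tau)=\sum_{n\ge0}\ \sum_{(k_1,\dots,k_n)\in\mathbb Z_{\ge0}^n}(-2\pi i)^n\,\mathcal G(2k_1,\dots,2k_n;\tau)\;\varepsilon_{2k_1}\circ\cdots\circ\varepsilon_{2k_n},$$ viewed as a (continuous) automorphism of $\mathfrak p_{\mathbb C}$. **Regularized integral.** With $a_0(G_{2k})=-\frac{B_{2k}}{4k}$ and $P(z)$ a polynomial, $\int_\tau^{\overrightarrow1_\infty}G_{2k}(z)P(z)\,dz=\int_\tau^{i\infty}(G_{2k}(z)-a_0(G_{2k}))P(z)\,dz-\int_0^\tau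 a_0(G_{2k})P(z)\,dz$; it is applied to $\underline G_{2k}$ coefficientwise in $\mathsf U,\mathsf V$, with the $\tau$ inside $\mathsf W$ held fixed. *)

(* Defs.v *)
From HB Require Import structures.
From mathcomp Require Import all_boot all_order all_algebra finmap.
From mathcomp Require Import generic_quotient.
From mathcomp Require Import all_classical all_reals all_analysis.
From mathcomp.analysis.showcase Require Import summability.
From mathcomp Require Import complex.

Set Implicit Arguments.
Unset Strict Implicit.
Unset Printing Implicit Defensive.

Import Order.TTheory GRing.Theory Num.Theory.
Import numFieldNormedType.Exports.

Local Open Scope classical_set_scope.
Local Open Scope ring_scope.
Local Open Scope quotient_scope.

Section Submodule.
Context (K : nzRingType) (V : lmodType K).

Record submodule := Submodule {
  subm_set :> V -> Prop;
  subm0 : subm_set 0;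
  submD : forall x y, subm_set x -> subm_set y -> subm_set (x + y);
  submZ : forall (c : K) x, subm_set x -> subm_set (c *: x) }.

Inductive lspan (S : set V) : set V :=
| lspan0 : lspan S 0
| lspan_gen v : S v -> lspan S v
| lspanD x y : lspan S x -> lspan S y -> lspan S (x + y)
| lspanZ (c : K) x : lspan S x -> lspan S (c *: x).

Lemma submN (S : submodule) x : S x -> S (- x).
Proof. by move=> Sx; rewrite -scaleN1r; apply: submZ. Qed.

Lemma submB (S : submodule) x y : S x -> S y -> S (x - y).
Proof. by move=> Sx Sy; apply: submD => //; apply: submN. Qed.

End Submodule.
Arguments submodule {K} V.

Section QuotientModule.
Context (K : nzRingType) (V : lmodType K) (S : submodule V).

Definition eqmodm (x y : V) : bool := `[< S (x - y) >].

Let eqmodm_refl : reflexive eqmodm.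
Proof. by move=> x; apply/asboolP; rewrite subrr; apply: subm0. Qed.

Let eqmodm_sym : symmetric eqmodm.
Proof.
by move=> x y; apply/asboolP/asboolP => /submN; rewrite opprB.
Qed.

Let eqmodm_trans : transitive eqmodm.
Proof.
move=> y x z /asboolP xy /asboolP yz; apply/asboolP.
by have := submD xy yz; rewrite addrA subrK.
Qed.

Canonical eqmodm_equiv := EquivRel eqmodm eqmodm_refl eqmodm_sym eqmodm_trans.

Definition quotm := {eq_quot eqmodm_equiv}.
HB.instance Definition _ : EqQuotient V eqmodm_equiv quotm :=
  EqQuotient.on quotm.
HB.instance Definition _ := Choice.on quotm.

Lemma quotmW (P : quotm -> Prop) :
  (forall x : V, P (\pi_quotm x)) -> forall q, P q.
Proof. by move=> h q; rewrite -[q]reprK. Qed.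

Lemma quotm_eq (x y : V) : (\pi_quotm x = \pi_quotm y) <-> S (x - y).
Proof.
split=> [/eqquotP /asboolP //|h]; by apply/eqquotP/asboolP.
Qed.

Lemma quotm_repr (x : V) : S (repr (\pi_quotm x) - x).
Proof. by apply/quotm_eq; rewrite reprK. Qed.

Definition quotm_add (x y : quotm) : quotm := \pi_quotm (repr x + repr y).
Definition quotm_opp (x : quotm) : quotm := \pi_quotm (- repr x).
Definition quotm_scale (c : K) (x : quotm) : quotm := \pi_quotm (c *: repr x).

Let addE x y : quotm_add (\pi_quotm x) (\pi_quotm y) = \pi_quotm (x + y).
Proof.
apply/quotm_eq; rewrite opprD addrACA; apply: submD; exact: quotm_repr.
Qed.

Let oppE x : quotm_opp (\pi_quotm x) = \pi_quotm (- x).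
Proof. by apply/quotm_eq; rewrite -opprD; apply: submN; exact: quotm_repr. Qed.

Let scaleE c x : quotm_scale c (\pi_quotm x) = \pi_quotm (c *: x).
Proof.
by apply/quotm_eq; rewrite -scalerBr; apply: submZ; exact: quotm_repr.
Qed.

Let addA : associative quotm_add.
Proof.
by move=> x y z; elim/quotmW: x => x; elim/quotmW: y => y; elim/quotmW: z => z; rewrite !addE addrA.
Qed.

Let addC : commutative quotm_add.
Proof. by move=> x y; elim/quotmW: x => x; elim/quotmW: y => y; rewrite !addE addrC. Qed.

Let add0 : left_id (\pi_quotm 0) quotm_add.
Proof. by move=> x; elim/quotmW: x => x; rewrite addE add0r. Qed.

Let addN : left_inverse (\pi_quotm 0) quotm_opp quotm_add.
Proof. by move=> x; elim/quotmW: x => x; rewrite oppE addE addNr. Qed.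

HB.instance Definition _ := GRing.isZmodule.Build quotm addA addC add0 addN.

Let scaleA c d x : quotm_scale c (quotm_scale d x) = quotm_scale (c * d) x.
Proof. by elim/quotmW: x => x; rewrite !scaleE scalerA. Qed.

Let scale1 : left_id 1 quotm_scale.
Proof. by move=> x; elim/quotmW: x => x; rewrite scaleE scale1r. Qed.

Let scaleDr : right_distributive quotm_scale +%R.
Proof.
move=> c; move=> x y; elim/quotmW: x => x; elim/quotmW: y => y.
by rewrite /GRing.add /= addE !scaleE addE scalerDr.
Qed.

Let scaleDl x : {morph quotm_scale^~ x : c d / c + d}.
Proof.
move=> c d; elim/quotmW: x => x.
by rewrite /GRing.add /= !scaleE addE scalerDl.
Qed.

HB.instance Definition _ :=
  GRing.Zmodule_isLmodule.Build K quotm scaleA scale1 scaleDr scaleDl.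

Lemma quotm_piD x y : \pi_quotm x + \pi_quotm y = \pi_quotm (x + y).
Proof. exact: addE. Qed.

Lemma quotm_piN x : - \pi_quotm x = \pi_quotm (- x).
Proof. exact: oppE. Qed.

Lemma quotm_piB x y : \pi_quotm x - \pi_quotm y = \pi_quotm (x - y).
Proof. by rewrite quotm_piN quotm_piD. Qed.

Lemma quotm_piZ c x : c *: \pi_quotm x = \pi_quotm (c *: x).
Proof. exact: scaleE. Qed.

End QuotientModule.

HB.mixin Record Lmodule_isLie (K : comNzRingType) L of GRing.Lmodule K L := {
  lie : L -> L -> L;
  lieDl : forall x y z, lie (x + y) z = lie x z + lie y z;
  lieDr : forall x y z, lie x (y + z) = lie x y + lie x z;
  lieZl : forall (c : K) x y, lie (c *: x) y = c *: lie x y;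
  lieZr : forall (c : K) x y, lie x (c *: y) = c *: lie x y;
  liexx : forall x, lie x x = 0;
  lie_jacobi : forall x y z,
    lie x (lie y z) + lie y (lie z x) + lie z (lie x y) = 0 }.

#[short(type="lieAlgType")]
HB.structure Definition LieAlgebra (K : comNzRingType) :=
  { L of Lmodule_isLie K L & GRing.Lmodule K L }.

Notation "[ 'lie' x , y ]" := (lie x y) (at level 0, format "[ 'lie'  x ,  y ]")
  : ring_scope.

Section LieTheory.
Context (K : comNzRingType) (L : lieAlgType K).
Implicit Types x y z : L.

Lemma lie0l y : [lie 0 : L, y] = 0.
Proof. by rewrite -[X in lie X _](scale0r (0 : L)) lieZl scale0r. Qed.

Lemma lie0r x : [lie x, 0 : L] = 0.
Proof. by rewrite -[X in lie _ X](scale0r (0 : L)) lieZr scale0r. Qed.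

Lemma lieNl x y : [lie - x, y] = - [lie x, y].
Proof. by rewrite -scaleN1r lieZl scaleN1r. Qed.

Lemma lieNr x y : [lie x, - y] = - [lie x, y].
Proof. by rewrite -scaleN1r lieZr scaleN1r. Qed.

Lemma lieBl x y z : [lie x - y, z] = [lie x, z] - [lie y, z].
Proof. by rewrite lieDl lieNl. Qed.

Lemma lieBr x y z : [lie x, y - z] = [lie x, y] - [lie x, z].
Proof. by rewrite lieDr lieNr. Qed.

Definition adn (k : nat) (x y : L) : L := iter k (lie x) y.

Definition lie_set (A B : set L) : set L :=
  lspan [set z | exists x y, [/\ A x, B y & z = [lie x, y]]].

(* [lcs n] is the (n+1)-st term of the lower central series:
   [lcs 0] is the whole of L. *)
Fixpoint lcs (n : nat) : set L :=
  if n is m.+1 then lie_set setT (lcs m) else setT.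

Lemma lcs0 n : lcs n 0. Proof. by case: n => //= n; apply: lspan0. Qed.

Lemma lcsD n x y : lcs n x -> lcs n y -> lcs n (x + y).
Proof. by case: n => //= n; apply: lspanD. Qed.

Lemma lcsZ n (c : K) x : lcs n x -> lcs n (c *: x).
Proof. by case: n => //= n; apply: lspanZ. Qed.

Definition lcs_subm n : submodule L :=
  Submodule (@lcs0 n) (@lcsD n) (@lcsZ n).

Lemma lcsN n x : lcs n x -> lcs n (- x). Proof. exact: (@submN _ _ (lcs_subm n)). Qed.

Lemma lcsB n x y : lcs n x -> lcs n y -> lcs n (x - y).
Proof. exact: (@submB _ _ (lcs_subm n)). Qed.

Lemma lcs_lieS n x y : lcs n y -> lcs n.+1 [lie x, y].
Proof. by move=> ny; apply: lspan_gen; exists x, y. Qed.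

Lemma lcs_subS n : lcs n.+1 `<=` lcs n.
Proof.
elim: n => [//|n IH] x /=; elim=> {x} [|x [u [v [_ lv ->]]]|x y _ ? _ ?|c x _ ?].
- exact: lspan0.
- by apply: lspan_gen; exists u, v; split=> //; apply: IH.
- exact: lspanD.
- exact: lspanZ.
Qed.

Lemma lcs_sub m n : (m <= n)%N -> lcs n `<=` lcs m.
Proof.
move=> /subnK <-; elim: (n - m)%N => [//|k IH] x.
by rewrite addSn => /lcs_subS /IH.
Qed.

Lemma lcs_lier n x y : lcs n y -> lcs n [lie x, y].
Proof. by move=> /(lcs_lieS x) /lcs_subS. Qed.

Lemma lie_antisym x y : [lie x, y] = - [lie y, x].
Proof.
apply/eqP; rewrite -addr_eq0; apply/eqP.
by have := liexx (x + y); rewrite lieDl !lieDr !liexx add0r addr0.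
Qed.

Lemma lcs_liel n x y : lcs n x -> lcs n [lie x, y].
Proof. by move=> nx; rewrite lie_antisym; apply/lcsN/lcs_lier. Qed.

End LieTheory.

Section FreeLie.
Context (K : comNzRingType) (X : Type).

Inductive lterm : Type :=
| LGen of X
| LZero
| LAdd of lterm & lterm
| LScale of K & lterm
| LBr of lterm & lterm.

Let LOpp := LScale (-1).

Inductive lterm_eq : lterm -> lterm -> Prop :=
| lteq_refl t : lterm_eq t t
| lteq_sym s t : lterm_eq s t -> lterm_eq t s
| lteq_trans s t u : lterm_eq s t -> lterm_eq t u -> lterm_eq s u
| lteq_add s s' t t' :
    lterm_eq s s' -> lterm_eq t t' -> lterm_eq (LAdd s t) (LAdd s' t')
| lteq_scale c t t' : lterm_eq t t' -> lterm_eq (LScale c t) (LScale c t')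
| lteq_br s s' t t' :
    lterm_eq s s' -> lterm_eq t t' -> lterm_eq (LBr s t) (LBr s' t')
| lteq_addA s t u : lterm_eq (LAdd s (LAdd t u)) (LAdd (LAdd s t) u)
| lteq_addC s t : lterm_eq (LAdd s t) (LAdd t s)
| lteq_add0 t : lterm_eq (LAdd LZero t) t
| lteq_addN t : lterm_eq (LAdd (LScale (-1) t) t) LZero
| lteq_scaleA c d t : lterm_eq (LScale c (LScale d t)) (LScale (c * d) t)
| lteq_scale1 t : lterm_eq (LScale 1 t) t
| lteq_scaleDr c s t :
    lterm_eq (LScale c (LAdd s t)) (LAdd (LScale c s) (LScale c t))
| lteq_scaleDl c d t :
    lterm_eq (LScale (c + d) t) (LAdd (LScale c t) (LScale d t))
| lteq_brDl s t u : lterm_eq (LBr (LAdd s t) u) (LAdd (LBr s u) (LBr t u))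
| lteq_brDr s t u : lterm_eq (LBr s (LAdd t u)) (LAdd (LBr s t) (LBr s u))
| lteq_brZl c s t : lterm_eq (LBr (LScale c s) t) (LScale c (LBr s t))
| lteq_brZr c s t : lterm_eq (LBr s (LScale c t)) (LScale c (LBr s t))
| lteq_brxx t : lterm_eq (LBr t t) LZero
| lteq_jacobi s t u :
    lterm_eq (LAdd (LAdd (LBr s (LBr t u)) (LBr t (LBr u s)))
                   (LBr u (LBr s t))) LZero.

HB.instance Definition _ := gen_eqMixin lterm.
HB.instance Definition _ := gen_choiceMixin lterm.

Definition lterm_eqb (s t : lterm) : bool := `[< lterm_eq s t >].

Let lterm_eqb_refl : reflexive lterm_eqb.
Proof. by move=> t; apply/asboolP; apply: lteq_refl. Qed.

Let lterm_eqb_sym : symmetric lterm_eqb.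
Proof. by move=> s t; apply/asboolP/asboolP; apply: lteq_sym. Qed.

Let lterm_eqb_trans : transitive lterm_eqb.
Proof.
by move=> t s u /asboolP st /asboolP tu; apply/asboolP; apply: lteq_trans tu.
Qed.

Canonical lterm_equiv :=
  EquivRel lterm_eqb lterm_eqb_refl lterm_eqb_sym lterm_eqb_trans.

Definition freeLie := {eq_quot lterm_equiv}.
HB.instance Definition _ : EqQuotient lterm lterm_equiv freeLie :=
  EqQuotient.on freeLie.
HB.instance Definition _ := Choice.on freeLie.

Notation pi := (\pi_freeLie).

Lemma freeLieW (P : freeLie -> Prop) :
  (forall t : lterm, P (pi t)) -> forall x, P x.
Proof. by move=> h x; rewrite -[x]reprK. Qed.

Let piP s t : lterm_eq s t -> pi s = pi t.
Proof. by move=> st; apply/eqquotP/asboolP. Qed.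

Let reprP t : lterm_eq (repr (pi t)) t.
Proof. by apply/asboolP; apply/(@eqquotP _ _ freeLie); rewrite reprK. Qed.

Definition flie_add (x y : freeLie) : freeLie := pi (LAdd (repr x) (repr y)).
Definition flie_opp (x : freeLie) : freeLie := pi (LOpp (repr x)).
Definition flie_scale (c : K) (x : freeLie) : freeLie := pi (LScale c (repr x)).
Definition flie_br (x y : freeLie) : freeLie := pi (LBr (repr x) (repr y)).

Let addE s t : flie_add (pi s) (pi t) = pi (LAdd s t).
Proof. by apply: piP; apply: lteq_add; apply: reprP. Qed.
Let oppE s : flie_opp (pi s) = pi (LOpp s).
Proof. by apply: piP; apply: lteq_scale; apply: reprP. Qed.
Let scaleE c s : flie_scale c (pi s) = pi (LScale c s).
Proof. by apply: piP; apply: lteq_scale; apply: reprP. Qed.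
Let brE s t : flie_br (pi s) (pi t) = pi (LBr s t).
Proof. by apply: piP; apply: lteq_br; apply: reprP. Qed.

Let addA : associative flie_add.
Proof.
move=> x y z; elim/freeLieW: x => x; elim/freeLieW: y => y; elim/freeLieW: z => z; rewrite !addE.
exact/piP/lteq_addA.
Qed.

Let addC : commutative flie_add.
Proof.
by move=> x y; elim/freeLieW: x => x; elim/freeLieW: y => y; rewrite !addE; apply/piP/lteq_addC.
Qed.

Let add0 : left_id (pi LZero) flie_add.
Proof. by move=> x; elim/freeLieW: x => x; rewrite addE; apply/piP/lteq_add0. Qed.

Let addN : left_inverse (pi LZero) flie_opp flie_add.
Proof. by move=> x; elim/freeLieW: x => x; rewrite oppE addE; apply/piP/lteq_addN. Qed.

HB.instance Definition _ := GRing.isZmodule.Build freeLie addA addC add0 addN.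

Let scaleA c d x : flie_scale c (flie_scale d x) = flie_scale (c * d) x.
Proof. by elim/freeLieW: x => x; rewrite !scaleE; apply/piP/lteq_scaleA. Qed.

Let scale1 : left_id 1 flie_scale.
Proof. by move=> x; elim/freeLieW: x => x; rewrite scaleE; apply/piP/lteq_scale1. Qed.

Let scaleDr : right_distributive flie_scale +%R.
Proof.
move=> c; move=> x y; elim/freeLieW: x => x; elim/freeLieW: y => y.
by rewrite /GRing.add /= addE !scaleE addE; apply/piP/lteq_scaleDr.
Qed.

Let scaleDl x : {morph flie_scale^~ x : c d / c + d}.
Proof.
move=> c d; elim/freeLieW: x => x.
by rewrite [RHS]/GRing.add /= !scaleE addE; apply/piP/lteq_scaleDl.
Qed.

HB.instance Definition _ :=
  GRing.Zmodule_isLmodule.Build K freeLie scaleA scale1 scaleDr scaleDl.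

Let brDl (x y z : freeLie) :
  flie_br (x + y) z = flie_br x z + flie_br y z.
Proof.
elim/freeLieW: x => x; elim/freeLieW: y => y; elim/freeLieW: z => z.
by rewrite /GRing.add /= addE !brE addE; apply/piP/lteq_brDl.
Qed.

Let brDr (x y z : freeLie) :
  flie_br x (y + z) = flie_br x y + flie_br x z.
Proof.
elim/freeLieW: x => x; elim/freeLieW: y => y; elim/freeLieW: z => z.
by rewrite /GRing.add /= addE !brE addE; apply/piP/lteq_brDr.
Qed.

Let brZl (c : K) (x y : freeLie) : flie_br (c *: x) y = c *: flie_br x y.
Proof.
elim/freeLieW: x => x; elim/freeLieW: y => y.
by rewrite /GRing.scale /= scaleE !brE scaleE; apply/piP/lteq_brZl.
Qed.

Let brZr (c : K) (x y : freeLie) : flie_br x (c *: y) = c *: flie_br x y.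
Proof.
elim/freeLieW: x => x; elim/freeLieW: y => y.
by rewrite /GRing.scale /= scaleE !brE scaleE; apply/piP/lteq_brZr.
Qed.

Let brxx (x : freeLie) : flie_br x x = 0.
Proof. by elim/freeLieW: x => x; rewrite brE; apply/piP/lteq_brxx. Qed.

Let br_jacobi (x y z : freeLie) :
  flie_br x (flie_br y z) + flie_br y (flie_br z x) + flie_br z (flie_br x y)
  = 0.
Proof.
elim/freeLieW: x => x; elim/freeLieW: y => y; elim/freeLieW: z => z.
by rewrite /GRing.add /= !brE !addE; apply/piP/lteq_jacobi.
Qed.

HB.instance Definition _ :=
  Lmodule_isLie.Build K freeLie brDl brDr brZl brZr brxx br_jacobi.

Definition flie_gen (x : X) : freeLie := pi (LGen x).

End FreeLie.

Section Completion.
Context (K : comNzRingType) (L : lieAlgType K).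

(* Sequences (x_n) whose classes in the quotients L / lcs n are compatible. *)
Definition coherent : {pred nat -> L} :=
  [pred x : nat -> L | `[< forall n, lcs n (x n.+1 - x n) >]].

Let coherent_submod : submod_closed coherent.
Proof.
split=> [|c x y /asboolP hx /asboolP hy]; apply/asboolP => n.
  by rewrite subrr; apply: lcs0.
rewrite -[X in lcs n X]/((c *: x n.+1 + y n.+1) - (c *: x n + y n)).
by rewrite opprD addrACA -scalerBr; apply: lcsD => //; apply: lcsZ.
Qed.

HB.instance Definition _ :=
  GRing.isSubmodClosed.Build K (nat -> L) coherent coherent_submod.

Record cohseq := CohSeq { cohval :> nat -> L; _ : cohval \in coherent }.

HB.instance Definition _ := [isSub for cohval].
HB.instance Definition _ := [Choice of cohseq by <:].
HB.instance Definition _ := [SubChoice_isSubLmodule of cohseq by <:].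

Lemma cohseqP (x : cohseq) n : lcs n (x n.+1 - x n).
Proof. by case: x => x /= /asboolP. Qed.

Let null_set : set cohseq := [set x | forall n, lcs n (x n)].

Let null0 : null_set 0. Proof. by move=> n; apply: lcs0. Qed.

Let nullD x y : null_set x -> null_set y -> null_set (x + y).
Proof. by move=> hx hy n; apply: lcsD. Qed.

Let nullZ (c : K) x : null_set x -> null_set (c *: x).
Proof. by move=> hx n; apply: lcsZ. Qed.

(* Coherent sequences that vanish in every quotient L / lcs n. *)
Definition null_seq : submodule cohseq := Submodule null0 nullD nullZ.

Definition completion : Type := quotm null_seq.
HB.instance Definition _ := GRing.Lmodule.on completion.
HB.instance Definition _ : EqQuotient cohseq (eqmodm_equiv null_seq) completion
  := EqQuotient.on completion.

Notation pi := (\pi_completion).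

Lemma completionW (P : completion -> Prop) :
  (forall x : cohseq, P (pi x)) -> forall x, P x.
Proof. by move=> h x; rewrite -[x]reprK. Qed.

Let brc_subproof (x y : cohseq) :
  (fun n => [lie x n, y n]) \in coherent.
Proof.
apply/asboolP => n.
have -> : [lie x n.+1, y n.+1] - [lie x n, y n] =
    [lie x n.+1 - x n, y n.+1] + [lie x n, y n.+1 - y n].
  by rewrite lieBl lieBr addrA subrK.
by apply: lcsD; [apply: lcs_liel|apply: lcs_lier]; apply: cohseqP.
Qed.

Definition cohseq_br (x y : cohseq) : cohseq := CohSeq (brc_subproof x y).

Definition completion_br (x y : completion) : completion :=
  pi (cohseq_br (repr x) (repr y)).

Lemma completion_eq (x y : cohseq) :
  (forall n, lcs n (x n - y n)) -> pi x = pi y.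
Proof. by move=> h; apply/quotm_eq. Qed.

Lemma completion_repr (x : cohseq) n : lcs n (repr (pi x) n - x n).
Proof. exact: (@quotm_repr _ _ null_seq x n). Qed.

Let brE x y : completion_br (pi x) (pi y) = pi (cohseq_br x y).
Proof.
apply: completion_eq => n /=.
set u := repr (pi x) n; set v := repr (pi y) n.
have -> : [lie u, v] - [lie x n, y n] = [lie u - x n, v] + [lie x n, v - y n].
  by rewrite lieBl lieBr addrA subrK.
by apply: lcsD; [apply: lcs_liel|apply: lcs_lier]; apply: completion_repr.
Qed.

Let piD x y : pi x + pi y = pi (x + y). Proof. exact: quotm_piD. Qed.
Let piZ c x : c *: pi x = pi (c *: x). Proof. exact: quotm_piZ. Qed.

Let cohseq_ext (x y : cohseq) : (forall n, x n = y n) -> x = y.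
Proof. by move=> h; apply/val_inj/funext. Qed.

Let brDl x y z : completion_br (x + y) z = completion_br x z + completion_br y z.
Proof.
elim/completionW: x => x; elim/completionW: y => y; elim/completionW: z => z.
rewrite piD !brE piD; congr pi; apply: cohseq_ext => n; exact: lieDl.
Qed.

Let brDr x y z : completion_br x (y + z) = completion_br x y + completion_br x z.
Proof.
elim/completionW: x => x; elim/completionW: y => y; elim/completionW: z => z.
rewrite piD !brE piD; congr pi; apply: cohseq_ext => n; exact: lieDr.
Qed.

Let brZl (c : K) x y : completion_br (c *: x) y = c *: completion_br x y.
Proof.
elim/completionW: x => x; elim/completionW: y => y.
rewrite piZ !brE piZ; congr pi; apply: cohseq_ext => n; exact: lieZl.
Qed.

Let brZr (c : K) x y : completion_br x (c *: y) = c *: completion_br x y.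
Proof.
elim/completionW: x => x; elim/completionW: y => y.
rewrite piZ !brE piZ; congr pi; apply: cohseq_ext => n; exact: lieZr.
Qed.

Let brxx x : completion_br x x = 0.
Proof.
elim/completionW: x => x; rewrite brE.
congr pi; apply: cohseq_ext => n; exact: liexx.
Qed.

Let br_jacobi x y z :
  completion_br x (completion_br y z) + completion_br y (completion_br z x)
  + completion_br z (completion_br x y) = 0.
Proof.
elim/completionW: x => x; elim/completionW: y => y; elim/completionW: z => z.
rewrite !brE !piD; congr pi; apply: cohseq_ext => n; exact: lie_jacobi.
Qed.

HB.instance Definition _ :=
  Lmodule_isLie.Build K completion brDl brDr brZl brZr brxx br_jacobi.

(* Kernel of the projection to L / lcs n. *)
Definition cfilt (n : nat) : set completion := [set x | lcs n ((repr x : cohseq) n)].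

Lemma cfiltE n x : cfilt n (pi x) <-> lcs n (x n).
Proof.
split=> h; first by rewrite -(subKr (repr (pi x) n) (x n));
  apply: lcsB => //; apply: completion_repr.
by rewrite /cfilt /= -(subrK (x n) (repr (pi x) n));
  apply: lcsD => //; apply: completion_repr.
Qed.

Lemma cfilt0 n : cfilt n 0.
Proof. by apply/(cfiltE n 0); apply: lcs0. Qed.

Lemma cfiltD n x y : cfilt n x -> cfilt n y -> cfilt n (x + y).
Proof.
elim/completionW: x => x; elim/completionW: y => y; rewrite piD !cfiltE; exact: lcsD.
Qed.

Lemma cfiltZ n (c : K) x : cfilt n x -> cfilt n (c *: x).
Proof. elim/completionW: x => x; rewrite piZ !cfiltE; exact: lcsZ. Qed.

Lemma cfiltN n x : cfilt n x -> cfilt n (- x).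
Proof. by rewrite -scaleN1r; apply: cfiltZ. Qed.

Lemma cfilt_sub m n : (m <= n)%N -> cfilt n `<=` cfilt m.
Proof.
move=> /subnK <-; elim: (n - m)%N => [//|k IH] x.
rewrite addSn => hx; apply: IH; move: hx.
elim/completionW: x => x; rewrite !cfiltE => /lcs_subS hx.
rewrite -(subKr (x (k + m).+1) (x (k + m)%N)).
by apply: lcsB => //; apply: cohseqP.
Qed.

(* The linear topology of the inverse limit of the L / lcs n. *)
Definition completion_nbhs (x : completion) : set_system completion :=
  [set A | exists n, forall y, cfilt n (y - x) -> A y].

HB.instance Definition _ := isPointed.Build completion 0.
HB.instance Definition _ := hasNbhs.Build completion completion_nbhs.

Let nbhs_pfilter (x : completion) : ProperFilter (nbhs x).
Proof.
apply: Build_ProperFilter_ex.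
  by move=> A [n hA]; exists x; apply: hA; rewrite subrr; apply: cfilt0.
split; first by exists 0%N.
- move=> A B [m hA] [n hB]; exists (maxn m n) => y hy; split.
    by apply: hA; apply: cfilt_sub hy; apply: leq_maxl.
  by apply: hB; apply: cfilt_sub hy; apply: leq_maxr.
- by move=> A B AB [n hA]; exists n => y /hA /AB.
Qed.

Let nbhs_singl (x : completion) (A : set completion) : nbhs x A -> A x.
Proof. by move=> [n hA]; apply: hA; rewrite subrr; apply: cfilt0. Qed.

Let nbhs_nb (x : completion) (A : set completion) :
  nbhs x A -> nbhs x (nbhs^~ A).
Proof.
move=> [n hA]; exists n => y hy; exists n => z hz; apply: hA.
by rewrite -(subrK y z) -addrA; apply: cfiltD.
Qed.

HB.instance Definition _ :=
  Nbhs_isNbhsTopological.Build completion nbhs_pfilter nbhs_singl nbhs_nb.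

Let cst_coherent (x : L) : (fun _ : nat => x) \in coherent.
Proof. by apply/asboolP => n; rewrite subrr; apply: lcs0. Qed.

Definition to_completion (x : L) : completion := pi (CohSeq (cst_coherent x)).

Section ClosedBracket.
Variables A B : set completion.
Let clAB := closure (lie_set A B).

Let clAB0 : clAB 0.
Proof. by apply: subset_closure; apply: lspan0. Qed.

Let clABD x y : clAB x -> clAB y -> clAB (x + y).
Proof.
move=> hx hy U [n hU].
have [|u [Su hu]] := hx [set z | cfilt n (z - x)]; first by exists n.
have [|v [Sv hv]] := hy [set z | cfilt n (z - y)]; first by exists n.
exists (u + v); split; first exact: lspanD.
by apply: hU; rewrite opprD addrACA; apply: cfiltD.
Qed.

Let clABZ (c : K) x : clAB x -> clAB (c *: x).
Proof.
move=> hx U [n hU].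
have [|u [Su hu]] := hx [set z | cfilt n (z - x)]; first by exists n.
exists (c *: u); split; first exact: lspanZ.
by apply: hU; rewrite -scalerBr; apply: cfiltZ.
Qed.

Definition closed_lie : submodule completion := Submodule clAB0 clABD clABZ.

End ClosedBracket.

End Completion.

Section FPS2.
Context (A : comNzRingType).

(* [f i j] is the coefficient of U^i V^j. *)
Definition fps2 : Type := nat -> nat -> A.

HB.instance Definition _ := GRing.Lmodule.copy fps2 (nat -> nat -> A^o).

Definition fps2_mul (f g : fps2) : fps2 := fun i j =>
  \sum_(p < i.+1) \sum_(q < j.+1) f p q * g (i - p)%N (j - q)%N.

Definition fps2_one : fps2 := fun i j => ((i == 0%N) && (j == 0%N))%:R.

Let tr n m (f : fps2) : {poly {poly A}} :=
  \poly_(i < n.+1) \poly_(j < m.+1) f i j.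

Let trE n m f i j : (i <= n)%N -> (j <= m)%N -> (tr n m f)`_i`_j = f i j.
Proof. by move=> hi hj; rewrite !coef_poly ltnS hi coef_poly ltnS hj. Qed.

Let mulE n m f g i j (P Q : {poly {poly A}}) : (i <= n)%N -> (j <= m)%N ->
  (forall i j, (i <= n)%N -> (j <= m)%N -> P`_i`_j = f i j) ->
  (forall i j, (i <= n)%N -> (j <= m)%N -> Q`_i`_j = g i j) ->
  (P * Q)`_i`_j = fps2_mul f g i j.
Proof.
move=> hi hj hP hQ; rewrite coefM coef_sum; apply: eq_bigr => p _.
rewrite coefM; apply: eq_bigr => q _.
have hp : (p <= n)%N by apply: leq_trans hi; rewrite -ltnS.
have hq : (q <= m)%N by apply: leq_trans hj; rewrite -ltnS.
rewrite hP // hQ //; [exact: leq_trans (leq_subr _ _) hi|].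
exact: leq_trans (leq_subr _ _) hj.
Qed.

Let trP n m f : forall i j, (i <= n)%N -> (j <= m)%N ->
  (tr n m f)`_i`_j = f i j.
Proof. by move=> i j; apply: trE. Qed.

Let trM n m f g : forall i j, (i <= n)%N -> (j <= m)%N ->
  (tr n m f * tr n m g)`_i`_j = fps2_mul f g i j.
Proof. by move=> i j hi hj; exact: (mulE hi hj (trP f) (trP g)). Qed.

Let mulA : associative fps2_mul.
Proof.
move=> f g h; apply/funext => i; apply/funext => j.
rewrite -(mulE (leqnn i) (leqnn j) (trP f) (trM g h)) mulrA.
exact: (mulE (leqnn i) (leqnn j) (trM f g) (trP h)).
Qed.

Let mulC : commutative fps2_mul.
Proof.
move=> f g; apply/funext => i; apply/funext => j.
rewrite -(mulE (leqnn i) (leqnn j) (trP f) (trP g)) mulrC.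
exact: (mulE (leqnn i) (leqnn j) (trP g) (trP f)).
Qed.

Let tr1 n m : forall i j, (i <= n)%N -> (j <= m)%N ->
  (1 : {poly {poly A}})`_i`_j = fps2_one i j.
Proof.
move=> i j _ _; rewrite coef1 /fps2_one; case: (i == 0%N) => /=.
  by rewrite coef1.
by rewrite coef0.
Qed.

Let mul1 : left_id fps2_one fps2_mul.
Proof.
move=> f; apply/funext => i; apply/funext => j.
rewrite -(mulE (leqnn i) (leqnn j) (@tr1 i j) (trP f)) mul1r.
exact: trE.
Qed.

Let mulDl : left_distributive fps2_mul +%R.
Proof.
move=> f g h; apply/funext => i; apply/funext => j.
have -> : (fps2_mul f h + fps2_mul g h) i j =
    fps2_mul f h i j + fps2_mul g h i j by [].
rewrite /fps2_mul -big_split; apply: eq_bigr => p _ /=.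
by rewrite -big_split; apply: eq_bigr => q _ /=; rewrite -mulrDl.
Qed.

Let one_neq0 : fps2_one != 0.
Proof.
apply/eqP => /(congr1 (fun f : fps2 => f 0%N 0%N)) /eqP.
by rewrite /fps2_one /= oner_eq0.
Qed.

HB.instance Definition _ :=
  GRing.Zmodule_isComNzRing.Build fps2 mulA mulC mul1 mulDl one_neq0.

Definition fpsU : fps2 := fun i j => ((i == 1%N) && (j == 0%N))%:R.
Definition fpsV : fps2 := fun i j => ((i == 0%N) && (j == 1%N))%:R.

End FPS2.

(* B_0, ..., B_n, from sum_(j <= m) 'C(m + 1, j) B_j = 0 for m >= 1. *)
Fixpoint bernoulli_seq (n : nat) : seq rat :=
  if n is m.+1 then
    let s := bernoulli_seq m in
    rcons s (- (\sum_(j < m.+1) 'C(m.+2, j)%:R * s`_j) / m.+2%:R)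
  else [:: 1].

Definition bernoulli (n : nat) : rat := (bernoulli_seq n)`_n.

Definition sigma (m n : nat) : nat := (\sum_(d <- divisors n) d ^ m)%N.

Section Eisenstein.
Context (R : realType).
Local Notation C := R[i].

Definition expC (z : C) : C :=
  (expR (complex.Re z))%:C%C *
  (cos (complex.Im z) +i* sin (complex.Im z))%C.

Definition twopii : C := ((0 : R) +i* (2 * pi))%C.

Definition qexp (tau : C) : C := expC (twopii * tau).

Definition upper_half : set C := [set tau | 0 < complex.Im tau].

(* Constant term of G_{2k}, for k >= 1. *)
Definition eis0 (k : nat) : C := - ratr (bernoulli (2 * k)) / (4 * k)%:R.

(* [eisenstein k] is G_{2k}, with G_0 = -1. *)
Definition eisenstein (k : nat) (tau : C) : C :=
  if k == 0%N then -1
  else eis0 k +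
    limn (series (fun n => (sigma (2 * k - 1) n.+1)%:R * qexp tau ^+ n.+1 : C^o)).

(* [G [:: k_1; ...; k_n] tau] stands for the iterated integral of
   G_{2k_1}, ..., G_{2k_n}. *)
Record iterated_eisenstein (G : seq nat -> C -> C) : Prop := {
  iterated_nil : forall tau, upper_half tau -> G [::] tau = 1;
  iterated_derive : forall k ks tau, upper_half tau ->
    is_derive (tau : C^o) 1 (G (k :: ks) : C^o -> C^o)
      (- eisenstein k tau * G ks tau);
  iterated_expansion : forall k ks,
    exists (N : nat) (c : nat -> nat -> C), c 0%N 0%N = 0 /\
      forall tau, upper_half tau ->
        (forall j, (j < N)%N ->
          cvgn (series (fun m => c j m * qexp tau ^+ m : C^o))) /\
        G (k :: ks) tau =
          \sum_(j < N) tau ^+ j * limn (series (fun m => c j m * qexp tau ^+ m : C^o)) }.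

Definition Cintegral (D : set R) (f : R -> C) : C :=
  ((\int[lebesgue_measure]_(t in D) complex.Re (f t))%R +i*
   (\int[lebesgue_measure]_(t in D) complex.Im (f t))%R)%C.

(* Regularized integral of G_{2k}(z) P(z) dz from tau to the tangential base
   point 1 at infinity, for k >= 1: the integrals are taken along the vertical
   half-line from tau and along the segment from 0 to tau. *)
Definition reg_integral (k : nat) (P : {poly C}) (tau : C) : C :=
  Cintegral `[0, +oo[%classic (fun t =>
    let z := tau + t%:C%C * 'i%C in (eisenstein k z - eis0 k) * P.[z] * 'i%C)
  - Cintegral `[0, 1]%classic (fun t => eis0 k * P.[t%:C%C * tau] * tau).

Definition Wser (tau : C) : fps2 C :=
  twopii^-1 *: fpsU C + tau *: fpsV C.

(* The cofactor (2 pi i)^(2k-1) (W - z V)^(2k-2) of G_{2k}(z) dz, whose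
   coefficients are polynomials in the variable z. *)
Definition eis_cofactor (k : nat) (tau : C) : fps2 {poly C} :=
  let W : fps2 {poly C} := fun i j => (Wser tau i j)%:P in
  (twopii ^+ (2 * k - 1))%:P *: (W - 'X *: fpsV {poly C}) ^+ (2 * k - 2).

Definition eis_integral (k : nat) (tau : C) : fps2 C :=
  fun i j => reg_integral k (eis_cofactor k tau i j) tau.

Definition eis_coef (k : nat) : C := 2 / ((2 * k - 2)`!)%:R.

Definition eis_sum (tau : C) : fps2 C := fun i j =>
  limn (fun N => \sum_(1 <= k < N) eis_coef k * eis_integral k tau i j : C^o).

Definition pC : Type := completion (freeLie C bool).
HB.instance Definition _ := LieAlgebra.on pC.
HB.instance Definition _ := PointedTopological.on pC.

Definition pa : pC := to_completion (flie_gen C true).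
Definition pb : pC := to_completion (flie_gen C false).

Definition eps_a (k : nat) : pC :=
  if k == 0%N then - pb else eis_coef k *: adn (2 * k) pa pb.

Definition eps_b (k : nat) : pC :=
  if k == 0%N then 0
  else eis_coef k *:
    \sum_(j < k) (-1) ^+ j *: [lie adn j pa pb, adn (2 * k - 1 - j) pa pb].

(* [is_eps k] characterizes epsilon_{2k}, the index being halved. *)
Record is_eps (k : nat) (e : pC -> pC) : Prop := {
  eps_linear : forall (c : C) x y, e (c *: x + y) = c *: e x + e y;
  eps_leibniz : forall x y, e [lie x, y] = [lie e x, y] + [lie x, e y];
  eps_continuous : continuous e;
  eps_pa : e pa = eps_a k;
  eps_pb : e pb = eps_b k }.

(* The sums over words and over pairs (k, l) below are unordered: limits along
   the finite subsets of the index set. *)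
Definition gaut (eps : nat -> pC -> pC) (G : seq nat -> C -> C) (tau : C)
    (x : pC) : pC :=
  lim (partial_sum (fun ks : seq nat =>
    ((- twopii) ^+ size ks * G ks tau) *: foldr eps x ks) @ totally).

Definition D1 : submodule pC := closed_lie setT setT.
Definition D2 : submodule pC := closed_lie D1 D1.

Definition metab (x : pC) : quotm D2 := \pi_(quotm D2) x.

(* The class in p / D^2 of the element of C a + C b + C[[U, V]] with
   components [alpha], [beta], [f]. *)
Definition metab_of (alpha beta : C) (f : fps2 C) : quotm D2 :=
  metab (alpha *: pa + beta *: pb +
    lim (partial_sum (fun kl : nat * nat =>
      f kl.1 kl.2 *: adn kl.1 pa (adn kl.2 pb [lie pa, pb])) @ totally)).

End Eisenstein.

(* Main.v *)
(* Modulo D^2 only few words act nontrivially: epsilon_{2k} with k >= 1 sends a and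
   b to multiples of U^(2k-1) and U^(2k-2) V and kills C[[U, V]], on which
   epsilon_0 acts as - V d/dU.  So g(tau) only involves the integrals
   G(0^j, 2k) and G(0^j, 2k, 0), and the latter reduce to the former by a shuffle
   relation.  On the other side, integrating by parts j times shows that the
   regularized integral of G_{2k}(z) (tau - z)^j / j! dz is G(0^j, 2k; tau); the two
   sides then agree coefficient by coefficient.  Identities between iterated
   integrals are proved by comparing derivatives, a function with derivative 0 that
   is asymptotic to a polynomial without constant term being 0.  The infinite sums
   are compared modulo D^2 + (n-th step of the filtration) for each n, since D^2 is
   closed. *)

Require Import Defs.
From HB Require Import structures.
From mathcomp Require Import all_boot all_order all_algebra finmap.
From mathcomp Require Import generic_quotient.
From mathcomp Require Import all_classical all_reals all_analysis.
From mathcomp.analysis.showcase Require Import summability.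
From mathcomp Require Import measurable_realfun.
From mathcomp Require Import complex zify ring lra.

Set Implicit Arguments.
Unset Strict Implicit.
Unset Printing Implicit Defensive.

Import Order.TTheory GRing.Theory Num.Theory.
Import numFieldNormedType.Exports.

Local Open Scope classical_set_scope.
Local Open Scope ring_scope.

(** Two obstacles shape the proof. Since epsilon_0 sends a to -b, it does not raise the degree in
    the lower central series, so that words with many zeros are not visibly summable for that
    filtration. Giving b twice the weight of a repairs this, and a large weight still forces a deep
    filtration step. On the analytic side no contour is moved: apart from a polynomial integral over
    the segment from 0 to tau, everything happens on the vertical ray from tau, where real calculus
    of the two components suffices. Adding a_0 z^(j+1)/(j+1)! to G(0^j, 2k) makes it rapidly
    decreasing there, and the segment removes the contribution of this polynomial. The two sides
    meet in falling factorials: on one side they come from the iterates of - V d/dU, on the other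
    from the binomial coefficients of (W - z V)^(2k-2) times the j! of repeated integration. For a,
    where W replaces V, the identity (n+1)^_(j+1) = n^_(j+1) + (j+1) n^_j, with n = 2k - 2, supplies
    the term that cancels the one left by the shuffle relation. *)

Notation normC := Normc.normc.

(** * Modulus, limits and dominated series of complex numbers *)

Section ComplexNorm.
Context (R : realType).
Local Notation C := R[i].
Implicit Types x y z : C.

Lemma normC_re z : `|complex.Re z| <= normC z.
Proof. by have := normc_ge_Re z; rewrite lecR. Qed.

Lemma normC_ge0 z : 0 <= normC z.
Proof. exact: le_trans (normr_ge0 _) (normC_re z). Qed.

Lemma normC_im z : `|complex.Im z| <= normC z.
Proof.
case: z => a b /=; rewrite -(sqrtr_sqr b) ler_wsqrtr // lerDr; exact: sqr_ge0.
Qed.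

Lemma normC_le z : normC z <= `|complex.Re z| + `|complex.Im z|.
Proof.
case: z => a b /=.
have h : 0 <= `|a| + `|b| by rewrite addr_ge0.
rewrite -(ger0_norm h) -sqrtr_sqr ler_wsqrtr //.
rewrite sqrrD !real_normK ?num_real // -addrA lerD2l lerDr mulrn_wge0 // mulr_ge0 //.
Qed.

Lemma normC_norm z : `|z| = (normC z)%:C%C. Proof. by []. Qed.

Lemma normCD x y : normC (x + y) <= normC x + normC y.
Proof. by have := ler_normD x y; rewrite !normC_norm -rmorphD lecR. Qed.

Lemma normCN x : normC (- x) = normC x.
Proof. by apply: (@complexI R); rewrite -!normC_norm normrN. Qed.

Lemma normCB x y : normC (x - y) <= normC x + normC y.
Proof. by rewrite -(normCN y) normCD. Qed.

Lemma normCM x y : normC (x * y) = normC x * normC y.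
Proof. by apply: (@complexI R); rewrite rmorphM /= -!normC_norm normrM. Qed.

Lemma normCX x n : normC (x ^+ n) = normC x ^+ n.
Proof. by elim: n => [|n IH]; rewrite ?expr0 ?Normc.normc1 // !exprS normCM IH. Qed.

Lemma normC_real (a : R) : normC a%:C%C = `|a|.
Proof. by rewrite /= expr0n addr0 sqrtr_sqr. Qed.

Lemma normC_nat n : normC (n%:R : C) = n%:R.
Proof. by rewrite -(rmorph_nat (real_complex R)) normC_real normr_nat. Qed.

Lemma normC_i : normC 'i%C = 1 :> R.
Proof. by rewrite /= expr0n add0r sqrtr_sqr normr1. Qed.

Lemma normC_sum n (f : nat -> C) :
  normC (\sum_(i < n) f i) <= \sum_(i < n) normC (f i).
Proof.
elim: n => [|n IH]; first by rewrite !big_ord0 Normc.normc0.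
by rewrite !big_ord_recr /=; apply: le_trans (normCD _ _) _; rewrite lerD2r.
Qed.

Lemma ReD x y : complex.Re (x + y) = complex.Re x + complex.Re y.
Proof. by case: x => ? ?; case: y. Qed.
Lemma ImD x y : complex.Im (x + y) = complex.Im x + complex.Im y.
Proof. by case: x => ? ?; case: y. Qed.
Lemma ReN x : complex.Re (- x) = - complex.Re x. Proof. by case: x. Qed.
Lemma ImN x : complex.Im (- x) = - complex.Im x. Proof. by case: x. Qed.

(** A positive element of the ordered field [R[i]] is real, so real radii suffice. *)
Lemma cvgC_dist (T : Type) (F : set_system T) (FF : Filter F) (f : T -> C) l :
  (forall e : R, 0 < e -> \forall x \near F, normC (l - f x) < e) <->
  ((f x : C^o) @[x --> F] --> (l : C^o)).
Proof.
split=> [h|/cvgrPdist_lt h e e0].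
  apply/cvgrPdist_lt => e e0.
  have Ie : complex.Im e = 0 by move: e0; rewrite ltcE /= => /andP[/eqP].
  have [r r0 ->] : exists2 r : R, 0 < r & e = r%:C%C.
    exists (complex.Re e); first by move: e0; rewrite ltcE /= => /andP[].
    by apply/eqP; rewrite eq_complex /= Ie !eqxx.
  by apply: filterS (h r r0) => x; rewrite normC_norm ltcR.
have /h : 0 < e%:C%C :> C by rewrite ltcR.
by apply: filterS => x; rewrite normC_norm ltcR.
Qed.

Lemma cvgC_comp (T : Type) (F : set_system T) (FF : Filter F) (f : T -> C) l :
  ((f x : C^o) @[x --> F] --> (l : C^o)) <->
  ((complex.Re (f x) @[x --> F] --> complex.Re l) /\
   (complex.Im (f x) @[x --> F] --> complex.Im l)).
Proof.
rewrite -cvgC_dist; split=> [h|[hr hi] e e0].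
  split; apply/cvgrPdist_lt => e e0; apply: filterS (h e e0) => x.
    by apply: le_lt_trans; apply: le_trans (normC_re _); rewrite ReD ReN.
  by apply: le_lt_trans; apply: le_trans (normC_im _); rewrite ImD ImN.
have e2 : 0 < e / 2 by rewrite divr_gt0.
move/cvgrPdist_lt: hr => /(_ _ e2) hr; move/cvgrPdist_lt: hi => /(_ _ e2) hi.
apply: filterS2 hr hi => x hr hi; apply: le_lt_trans (normC_le _) _.
by rewrite ReD ReN ImD ImN; lra.
Qed.

Lemma cvgCD (T : Type) (F : set_system T) (FF : Filter F) (f g : T -> C) a b :
  ((f x : C^o) @[x --> F] --> (a : C^o)) -> ((g x : C^o) @[x --> F] --> (b : C^o)) ->
  ((f x + g x : C^o) @[x --> F] --> (a + b : C^o)).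
Proof.
move=> /cvgC_comp [h1 h2] /cvgC_comp [k1 k2]; apply/cvgC_comp.
rewrite ReD ImD; split.
  by under eq_cvg do rewrite ReD; exact: cvgD.
by under eq_cvg do rewrite ImD; exact: cvgD.
Qed.

Lemma cvgCZ (T : Type) (F : set_system T) (FF : Filter F) (f : T -> C) a b :
  ((f x : C^o) @[x --> F] --> (a : C^o)) ->
  ((b * f x : C^o) @[x --> F] --> (b * a : C^o)).
Proof.
move=> /cvgC_dist h; apply/cvgC_dist => e e0.
have b0 : 0 < normC b + 1 by rewrite ltr_pwDr // normC_ge0.
apply: filterS (h _ (divr_gt0 e0 b0)) => x; rewrite ltr_pdivlMr // => hx.
rewrite -mulrBr normCM mulrC; apply: le_lt_trans hx.
by rewrite ler_wpM2l ?normC_ge0 // lerDl.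
Qed.

Lemma cvgCB (T : Type) (F : set_system T) (FF : Filter F) (f g : T -> C) a b :
  ((f x : C^o) @[x --> F] --> (a : C^o)) -> ((g x : C^o) @[x --> F] --> (b : C^o)) ->
  ((f x - g x : C^o) @[x --> F] --> (a - b : C^o)).
Proof.
move=> h k; rewrite -mulN1r.
have -> : (fun x : T => (f x - g x : C^o)) = (fun x : T => (f x + -1 * g x : C^o)).
  by apply/funext => x; rewrite mulN1r.
exact: (cvgCD _ h (@cvgCZ _ _ _ g b (-1) k)).
Qed.

Lemma Re_sum n (f : nat -> C) :
  complex.Re (\sum_(0 <= i < n) f i) = \sum_(0 <= i < n) complex.Re (f i).
Proof. by elim: n => [|n IH]; rewrite ?big_nil // !big_nat_recr //= ReD IH. Qed.
Lemma Im_sum n (f : nat -> C) :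
  complex.Im (\sum_(0 <= i < n) f i) = \sum_(0 <= i < n) complex.Im (f i).
Proof. by elim: n => [|n IH]; rewrite ?big_nil // !big_nat_recr //= ImD IH. Qed.

Lemma geometric_dominated (u : nat -> R) (K r : R) : 0 <= r < 1 ->
  (forall m, `|u m| <= K * r ^+ m) ->
  exists2 l, series u @ \oo --> l & `|l| <= K / (1 - r).
Proof.
move=> /andP[r0 r1] hu.
have K0 : 0 <= K by have := hu 0%N; rewrite expr0 mulr1; apply: le_trans.
have nr : `|r| < 1 by rewrite ger0_norm.
have geo := @cvg_geometric_series _ K r nr.
have cn : cvgn [normed series u].
  apply: (@series_le_cvg _ _ (geometric K r)) => [n|n|n|] /=.
  - exact: normr_ge0.
  - by rewrite mulr_ge0 // exprn_ge0.
  - exact: hu.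
  - by apply/cvg_ex; eexists; exact: geo.
exists (limn (series u)); first exact: normed_cvg.
apply: le_trans (lim_series_norm cn) _.
rewrite -(cvg_lim _ geo) //; apply: lim_series_le => //.
by apply/cvg_ex; eexists; exact: geo.
Qed.

Lemma geometric_dominatedC (u : nat -> C) (K r : R) : 0 <= r < 1 ->
  (forall m, normC (u m) <= K * r ^+ m) ->
  exists2 l, (series u : nat -> C^o) @ \oo --> (l : C^o) &
    normC l <= 2 * K / (1 - r).
Proof.
move=> hr hu.
have [a ca ha] : exists2 l, series (fun m => complex.Re (u m)) @ \oo --> l &
    `|l| <= K / (1 - r).
  apply: geometric_dominated => // m; exact: le_trans (normC_re _) (hu m).
have [b cb hb] : exists2 l, series (fun m => complex.Im (u m)) @ \oo --> l &
    `|l| <= K / (1 - r).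
  apply: geometric_dominated => // m; exact: le_trans (normC_im _) (hu m).
exists (a +i* b)%C; last first.
  by apply: le_trans (normC_le _) _; rewrite -mulrA mulr_natl mulr2n lerD.
apply/cvgC_comp; split.
  by apply: cvg_trans ca; apply: near_eq_cvg; near=> n; rewrite /series /= Re_sum.
by apply: cvg_trans cb; apply: near_eq_cvg; near=> n; rewrite /series /= Im_sum.
Unshelve. all: by end_near.
Qed.

End ComplexNorm.

(** * Power series in q controlled by a bound on their coefficients *)

Section PowerSeries.
Context (R : realType).
Local Notation C := R[i].
Implicit Types (c : nat -> C) (q : C).

Definition qser c q : C := limn (series (fun m => c m * q ^+ m : C^o)).

(** The bound of Abel's lemma: it follows from convergence at one point of modulus [rho > 0] and
    gives convergence for |q| < rho. *)
Definition coef_bounded c (rho : R) :=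
  exists K, forall m, normC (c m) * rho ^+ m <= K.

Lemma coef_bounded_geometric c rho r : 0 <= r < rho -> coef_bounded c rho ->
  exists K, forall q, normC q <= r ->
    forall m, normC (c m * q ^+ m) <= K * (r / rho) ^+ m.
Proof.
move=> /andP[r0 rr] [K hK]; have p0 : 0 < rho by exact: le_lt_trans rr.
exists K => q hq m; rewrite normCM normCX.
apply: (@le_trans _ _ ((normC (c m) * rho ^+ m) * (r / rho) ^+ m)).
  rewrite -mulrA -exprMn mulrCA divff ?gt_eqF // mulr1.
  by rewrite ler_wpM2l ?normC_ge0 // lerXn2r // ?nnegrE ?normC_ge0.
by rewrite ler_wpM2r ?hK // exprn_ge0 // divr_ge0 // ltW.
Qed.

Lemma ratio_lt1 (r rho : R) : 0 <= r < rho -> 0 <= r / rho < 1.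
Proof.
move=> /andP[r0 rr]; have p0 : 0 < rho by exact: le_lt_trans rr.
by rewrite ltr_pdivrMr // mul1r rr andbT divr_ge0 // ltW.
Qed.

Lemma qser_cvg c rho q : normC q < rho -> coef_bounded c rho ->
  series (fun m => c m * q ^+ m : C^o) @ \oo --> (qser c q : C^o).
Proof.
move=> hq hc; have hr : 0 <= normC q < rho by rewrite normC_ge0.
have [K hK] := coef_bounded_geometric hr hc.
have [l cl _] := geometric_dominatedC (ratio_lt1 hr) (hK q (lexx _)).
by apply/cvg_ex; exists l.
Qed.

Lemma qser_eq c q l :
  series (fun m => c m * q ^+ m : C^o) @ \oo --> (l : C^o) -> qser c q = l.
Proof. by move=> h; rewrite /qser (cvg_lim _ h). Qed.

Lemma qser_bound c rho r : 0 <= r < rho -> coef_bounded c rho ->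
  exists K, forall q, normC q <= r -> normC (qser c q) <= K.
Proof.
move=> hr hc; have [K hK] := coef_bounded_geometric hr hc.
exists (2 * K / (1 - r / rho)) => q hq.
have [l cl hl] := geometric_dominatedC (ratio_lt1 hr) (hK q hq).
by rewrite /qser (cvg_lim _ cl).
Qed.

Lemma coef_bounded_shift c rho : 0 < rho -> coef_bounded c rho ->
  coef_bounded (fun m => c m.+1) rho.
Proof.
move=> p0 [K hK]; exists (K / rho) => m.
by rewrite ler_pdivlMr // -mulrA -exprSr.
Qed.

Lemma qser_split c rho q : normC q < rho -> coef_bounded c rho ->
  qser c q = c 0%N + q * qser (fun m => c m.+1) q.
Proof.
move=> hq hc; have p0 : 0 < rho by apply: le_lt_trans hq; apply: normC_ge0.
have h1 := qser_cvg hq hc.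
have h2 := qser_cvg hq (coef_bounded_shift p0 hc).
apply: qser_eq; rewrite -cvg_shiftS.
have -> : [sequence series (fun m => c m * q ^+ m : C^o) n.+1]_n =
    (fun n => (c 0%N : C^o) + (q : C^o) * series (fun m => c m.+1 * q ^+ m : C^o) n).
  apply/funext => n; rewrite /series /= big_nat_recl // expr0 mulr1; congr (_ + _).
  by rewrite mulr_sumr; apply: eq_bigr => i _; rewrite mulrCA exprS.
by apply: cvgCD; [exact: cvg_cst | exact: cvgCZ].
Qed.

Lemma qser_tail_cvg c rho q : normC q < rho -> coef_bounded c rho ->
  series (fun m => c m.+1 * q ^+ m.+1 : C^o) @ \oo --> (qser c q - c 0%N : C^o).
Proof.
move=> hq hc; have hh := qser_cvg hq hc; rewrite -cvg_shiftS in hh.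
have -> : series (fun m => c m.+1 * q ^+ m.+1 : C^o) =
    (fun n => [sequence series (fun m => c m * q ^+ m : C^o) n.+1]_n n - (c 0%N : C^o)).
  by apply/funext => n; rewrite /series /= big_nat_recl // expr0 mulr1 addrC addKr.
by apply: cvgCB; [exact: hh | exact: cvg_cst].
Qed.

Lemma normC_subX q q' (r : R) m : normC q <= r -> normC q' <= r ->
  normC (q ^+ m.+1 - q' ^+ m.+1) <= m.+1%:R * r ^+ m * normC (q - q').
Proof.
move=> h h'; have r0 : 0 <= r by exact: le_trans (normC_ge0 _) h.
elim: m => [|m IH]; first by rewrite !expr1 expr0 !mul1r.
have -> : q ^+ m.+2 - q' ^+ m.+2 = q * (q ^+ m.+1 - q' ^+ m.+1) + (q - q') * q' ^+ m.+1.
  by rewrite (exprS q m.+1) (exprS q' m.+1); ring.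
apply: le_trans (normCD _ _) _; rewrite !normCM normCX.
have -> : m.+2%:R * r ^+ m.+1 * normC (q - q') =
   r * (m.+1%:R * r ^+ m * normC (q - q')) + normC (q - q') * r ^+ m.+1.
  by rewrite exprS; ring.
apply: lerD; last by rewrite ler_wpM2l ?normC_ge0 // lerXn2r // ?nnegrE ?normC_ge0.
by apply: ler_pM => //; apply: normC_ge0.
Qed.

Lemma bernoulli_inequality (R' : realDomainType) (x : R') n : 0 <= x -> 1 + n%:R * x <= (1 + x) ^+ n.
Proof.
move=> x0; elim: n => [|n IH]; first by rewrite mul0r addr0 expr0.
rewrite exprS; apply: (@le_trans _ _ ((1 + x) * (1 + n%:R * x))).
  rewrite -natr1; have : 0 <= n%:R * x * x by rewrite !mulr_ge0.
  by nra.
by rewrite ler_wpM2l // addr_ge0.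
Qed.

(** With 1 + x = rho / r, Bernoulli's inequality gives m x <= (rho / r)^m: the factor m is paid for
    by shrinking the radius. *)
Lemma coef_bounded_natmul c rho r : 0 <= r < rho -> coef_bounded c rho ->
  coef_bounded (fun m => m%:R * c m) r.
Proof.
move=> /andP[r0 rr] [K hK].
have p0 : 0 < rho by exact: le_lt_trans rr.
have [->|rn0] := eqVneq r 0.
  exists 0 => -[|m]; first by rewrite mul0r Normc.normc0 mul0r.
  by rewrite expr0n mulr0.
have r00 : 0 < r by rewrite lt_neqAle eq_sym rn0.
pose x := rho / r - 1.
have x0 : 0 < x by rewrite subr_gt0 ltr_pdivlMr // mul1r.
exists (K / x) => m; rewrite ler_pdivlMr //.
apply: le_trans (hK m); rewrite normCM normC_nat.
have -> : rho ^+ m = (1 + x) ^+ m * r ^+ m.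
  by rewrite -exprMn /x addrC subrK divfK.
have := bernoulli_inequality m (ltW x0); have := normC_ge0 (c m).
have : 0 <= r ^+ m by rewrite exprn_ge0.
move=> h1 h2 h3.
have -> : m%:R * normC (c m) * r ^+ m * x = normC (c m) * (m%:R * x * r ^+ m) by ring.
by rewrite ler_wpM2l // ler_wpM2r //; lra.
Qed.

(** Termwise, |q^(m+1) - q'^(m+1)| <= (m+1) r^m |q - q'|, and the intermediate radius s absorbs the
    factor m + 1. This serves for the continuity of G_{2k} along the ray. *)
Lemma qser_lipschitz c rho r : 0 <= r < rho -> coef_bounded c rho ->
  exists K, forall q q', normC q <= r -> normC q' <= r ->
    normC (qser c q - qser c q') <= K * normC (q - q').
Proof.
move=> /andP[r0 rr] hc; pose s := (r + rho) / 2.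
have hs : 0 <= s < rho by rewrite /s; apply/andP; split; lra.
have hrs : 0 <= r < s by rewrite /s r0 /=; lra.
have s0 : 0 < s by rewrite /s; lra.
clearbody s.
have p0 : 0 < rho by lra.
have [K hK] := coef_bounded_shift s0 (coef_bounded_natmul hs hc).
exists (2 * K / (1 - r / s)) => q q' hq hq'.
have h1 : series (fun m => c m.+1 * (q ^+ m.+1 - q' ^+ m.+1) : C^o) @ \oo -->
    (qser c q - qser c q' : C^o).
  have cv q1 (h : normC q1 <= r) := qser_tail_cvg (le_lt_trans h rr) hc.
  have -> : qser c q - qser c q' = (qser c q - c 0%N) - (qser c q' - c 0%N).
    by rewrite opprB addrA subrK.
  have -> : series (fun m => c m.+1 * (q ^+ m.+1 - q' ^+ m.+1) : C^o) =
     (fun n => series (fun m => c m.+1 * q ^+ m.+1 : C^o) n -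
        series (fun m => c m.+1 * q' ^+ m.+1 : C^o) n).
    apply/funext => n; rewrite /series /= -sumrB; apply: eq_bigr => i _; exact: mulrBr.
  by apply: cvgCB; exact: cv.
have h2 m : normC (c m.+1 * (q ^+ m.+1 - q' ^+ m.+1)) <=
    (K * normC (q - q')) * (r / s) ^+ m.
  rewrite normCM; apply: le_trans (ler_wpM2l (normC_ge0 _) (normC_subX m hq hq')) _.
  have := hK m; rewrite normCM normC_nat => h.
  have -> : normC (c m.+1) * (m.+1%:R * r ^+ m * normC (q - q')) =
     (m.+1%:R * normC (c m.+1) * s ^+ m) * normC (q - q') * (r / s) ^+ m.
    rewrite expr_div_n.
    by field; rewrite expf_neq0 // gt_eqF.
  rewrite ler_wpM2r ?exprn_ge0 ?divr_ge0 //; first exact: ltW.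
  by rewrite ler_wpM2r ?normC_ge0.
have [l cl hl] := geometric_dominatedC (ratio_lt1 hrs) h2.
rewrite -(cvg_lim _ h1) // (cvg_lim _ cl) //; apply: le_trans hl _.
by rewrite le_eqVlt; apply/orP; left; apply/eqP; rewrite -!mulrA; ring.
Qed.

Lemma cvg_coef_bounded c q : 0 < normC q ->
  cvgn (series (fun m => c m * q ^+ m : C^o)) -> coef_bounded c (normC q).
Proof.
move=> q0 /cvg_series_cvg_0 /cvgC_comp [/= hr hi].
have [A [_ hA]] := cvg_seq_bounded (cvgP _ hr).
have [B [_ hB]] := cvg_seq_bounded (cvgP _ hi).
exists ((A + 1) + (B + 1)) => m; rewrite -normCX -normCM.
apply: le_trans (normC_le _) _; apply: lerD.
  by apply: hA => //; rewrite ltrDl.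
by apply: hB => //; rewrite ltrDl.
Qed.

End PowerSeries.

(** * Decay and polynomial asymptotics along the vertical ray to the cusp *)

Section Ray.
Context (R : realType).
Local Notation C := R[i].
Implicit Types (tau z : C) (t : R).

Definition ray tau t : C := tau + t%:C%C * 'i%C.

Lemma ray0 tau : ray tau 0 = tau.
Proof. by rewrite /ray mul0r addr0. Qed.

Lemma Im_ray tau t : complex.Im (ray tau t) = complex.Im tau + t.
Proof. by case: tau => a b; rewrite /ray /=; ring. Qed.

Lemma upper_ray tau t : upper_half tau -> 0 <= t -> upper_half (ray tau t).
Proof. by rewrite /upper_half /= Im_ray => h t0; rewrite ltr_pwDl. Qed.

Lemma normC_expC z : normC (expC z) = expR (complex.Re z).
Proof.
rewrite /expC normCM normC_real ger0_norm ?expR_ge0 //=.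
by rewrite cos2Dsin2 sqrtr1 mulr1.
Qed.

Lemma expC_addr z t : expC (z + t%:C%C) = expC z * (expR t)%:C%C.
Proof. by case: z => a b; rewrite /expC /= addr0 expRD rmorphM /=; ring. Qed.

Lemma qexp_ray tau t :
  qexp (ray tau t) = qexp tau * (expR (- (2 * pi * t)))%:C%C.
Proof.
rewrite /qexp -expC_addr; congr expC; case: tau => a b.
rewrite /ray /twopii; simpc; congr (_ +i* _)%C; ring.
Qed.

Lemma normC_qexp tau : normC (qexp tau) = expR (- (2 * pi * complex.Im tau)).
Proof.
by rewrite /qexp normC_expC /twopii; congr expR; case: tau => a b /=; ring.
Qed.

Lemma normC_qexp_ray tau t :
  normC (qexp (ray tau t)) = normC (qexp tau) * expR (- (2 * pi * t)).
Proof. by rewrite qexp_ray normCM normC_real ger0_norm // expR_ge0. Qed.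

Lemma normC_qexp_lt tau tau' : complex.Im tau' < complex.Im tau ->
  normC (qexp tau) < normC (qexp tau').
Proof.
by move=> h; rewrite !normC_qexp ltr_expR ltrN2 ltr_pM2l // mulr_gt0 // pi_gt0.
Qed.

Lemma normC_qexp_ray_le tau t : 0 <= t ->
  normC (qexp (ray tau t)) <= normC (qexp tau).
Proof.
move=> t0; rewrite !normC_qexp ler_expR lerN2 ler_pM2l ?mulr_gt0 ?pi_gt0 //.
by rewrite Im_ray lerDl.
Qed.

(** A fixed exponential rate would be lost on multiplication by a polynomial in z; decay faster than
    every power is preserved. *)
Definition rapid (f : R -> C) :=
  forall M, exists K, forall t, 0 <= t -> normC (f t) * (1 + t) ^+ M <= K.

Lemma eq_rapid f g : (forall t, 0 <= t -> f t = g t) -> rapid f -> rapid g.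
Proof. by move=> h hf M; have [K hK] := hf M; exists K => t t0; rewrite -h // hK. Qed.

Lemma rapid0 : rapid (fun=> 0).
Proof. by move=> M; exists 0 => t _; rewrite Normc.normc0 mul0r. Qed.

Lemma rapidD f g : rapid f -> rapid g -> rapid (fun t => f t + g t).
Proof.
move=> hf hg M; have [K hK] := hf M; have [L hL] := hg M; exists (K + L) => t t0.
apply: le_trans (lerD (hK t t0) (hL t t0)); rewrite -mulrDl ler_wpM2r ?normCD //.
by rewrite exprn_ge0 // addr_ge0.
Qed.

Lemma rapidZ (a : C) f : rapid f -> rapid (fun t => a * f t).
Proof.
move=> hf M; have [K hK] := hf M; exists (normC a * K) => t t0.
by rewrite normCM -mulrA ler_wpM2l ?normC_ge0 ?hK.
Qed.

Lemma rapid_sum n (f : nat -> R -> C) : (forall i, (i < n)%N -> rapid (f i)) ->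
  rapid (fun t => \sum_(i < n) f i t).
Proof.
elim: n => [_|n IH h].
  by apply: eq_rapid rapid0 => t _; rewrite big_ord0.
apply: eq_rapid (rapidD (IH _) (h n _)) => //.
  by move=> t _; rewrite big_ord_recr.
by move=> i hi; apply: h; exact: ltnW.
Qed.

Lemma rapid_ray tau f : rapid f -> rapid (fun t => ray tau t * f t).
Proof.
move=> hf M; have [K hK] := hf M.+1; exists ((normC tau + 1) * K) => t t0.
have hr : normC (ray tau t) <= (normC tau + 1) * (1 + t).
  apply: le_trans (normCD _ _) _; rewrite normCM normC_real normC_i mulr1.
  by rewrite ger0_norm //; have := normC_ge0 tau; nra.
have h1 : 0 <= (1 + t) ^+ M by rewrite exprn_ge0 // addr_ge0.
rewrite normCM; apply: (@le_trans _ _ ((normC tau + 1) * (1 + t) * normC (f t) * (1 + t) ^+ M)).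
  by rewrite ler_wpM2r // ler_wpM2r ?normC_ge0.
have -> : (normC tau + 1) * (1 + t) * normC (f t) * (1 + t) ^+ M =
  (normC tau + 1) * (normC (f t) * (1 + t) ^+ M.+1) by rewrite exprS; ring.
by rewrite ler_wpM2l ?hK // addr_ge0 // normC_ge0.
Qed.

Lemma rapid_horner tau (p : {poly C}) f :
  rapid f -> rapid (fun t => p.[ray tau t] * f t).
Proof.
move=> hf; elim/poly_ind: p => [|p c IH].
  by apply: eq_rapid rapid0 => t _; rewrite horner0 mul0r.
apply: eq_rapid (rapidD (rapid_ray tau IH) (rapidZ c hf)) => t _.
by rewrite hornerMXaddC; ring.
Qed.

Lemma rapid_exp_bound f K :
  (forall t, 0 <= t -> normC (f t) <= K * expR (- (2 * pi * t))) -> rapid f.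
Proof.
move=> h M; exists (K * M.+1%:R ^+ M.+1) => t t0.
have K0 : 0 <= K.
  by have := le_trans (normC_ge0 _) (h 0 (lexx _)); rewrite mulr0 oppr0 expR0 mulr1.
(* From 1 + t <= (M+1) exp(t / (M+1)), raised to the power M + 1, which is never 0. The factor
   exp(t) is then beaten by exp(-2 pi t). *)
have hp : (1 + t) ^+ M <= M.+1%:R ^+ M.+1 * expR t.
  apply: (@le_trans _ _ ((1 + t) ^+ M.+1)).
    by rewrite ler_weXn2l // lerDl.
  have e1 : 1 + t <= M.+1%:R * expR (t / M.+1%:R).
    apply: (@le_trans _ _ (M.+1%:R * (1 + t / M.+1%:R))).
      rewrite mulrDr mulr1 mulrCA divff ?pnatr_eq0 // mulr1 lerD2r.
      by rewrite (ler_nat R 1).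
    by rewrite ler_wpM2l // expR_ge1Dx.
  have -> : expR t = expR (t / M.+1%:R) ^+ M.+1.
    by rewrite -expRM_natr divfK ?pnatr_eq0.
  by rewrite -exprMn lerXn2r // nnegrE ?addr_ge0 // mulr_ge0 // expR_ge0.
apply: le_trans (ler_wpM2r _ (h t t0)) _; first by rewrite exprn_ge0 // addr_ge0.
rewrite -(mulrA K) ler_wpM2l //.
apply: le_trans (ler_wpM2l (expR_ge0 _) hp) _.
rewrite mulrCA -expRD -[X in _ <= X]mulr1 ler_wpM2l ?exprn_ge0 //.
rewrite expR_le1; have := @pi_ge2 R; nra.
Qed.

Lemma rapid_qser tau c rho : normC (qexp tau) < rho -> coef_bounded c rho ->
  rapid (fun t => qser c (qexp (ray tau t)) - c 0%N).
Proof.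
move=> hq hc; have p0 : 0 < rho by apply: le_lt_trans hq; apply: normC_ge0.
have hr : 0 <= normC (qexp tau) < rho by rewrite normC_ge0.
have [K hK] := qser_bound hr (coef_bounded_shift p0 hc).
apply: (@rapid_exp_bound _ (normC (qexp tau) * K)) => t t0.
have hl := normC_qexp_ray_le tau t0.
rewrite (qser_split (le_lt_trans hl hq) hc) addrC addKr normCM normC_qexp_ray.
have := hK _ hl; have := expR_ge0 (- (2 * pi * t)); have := normC_ge0 (qexp tau).
move=> h1 h2 h3; rewrite -!mulrA ler_wpM2l // mulrC ler_wpM2r //.
Qed.

(* Vanishing at the tangential base point: up to a rapidly decreasing error, g is
   a polynomial without constant term along the vertical ray from tau. *)
Definition asym tau (g : C -> C) := exists p : {poly C},
  p.[0] = 0 /\ rapid (fun t => g (ray tau t) - p.[ray tau t]).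

Lemma asymD tau g h : asym tau g -> asym tau h -> asym tau (fun z => g z + h z).
Proof.
move=> [p [p0 hp]] [q [q0 hq]]; exists (p + q); rewrite hornerD p0 q0 addr0.
split=> //; apply: eq_rapid (rapidD hp hq) => t _; rewrite hornerD; ring.
Qed.

Lemma asym_horner tau g (q : {poly C}) : asym tau g -> asym tau (fun z => q.[z] * g z).
Proof.
move=> [p [p0 hp]]; exists (q * p); rewrite hornerM p0 mulr0; split=> //.
by apply: eq_rapid (rapid_horner tau q hp) => t _; rewrite hornerM; ring.
Qed.

Lemma asym_poly tau (p : {poly C}) : p.[0] = 0 -> asym tau (horner p).
Proof. by exists p; split=> //; apply: eq_rapid rapid0 => t _; rewrite subrr. Qed.

(** If the degree were n + 1 > 0, dividing the bound by t^n would leave |lc| t <= S + K for all t >=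
    1, with lc the leading coefficient and S the sum of the moduli of the others. *)
Lemma poly_bounded_const (p : {poly C}) K :
  (forall t, 0 <= t -> normC p.[t%:C%C] <= K) -> (size p <= 1)%N.
Proof.
move=> h; rewrite leqNgt; apply/negP => sp.
have [n sn] : exists n, size p = n.+2 by case: (size p) sp => [|[|n]] // _; exists n.
pose S := \sum_(i < n.+1) normC p`_i.
have lc : 0 < normC p`_n.+1.
  rewrite lt_neqAle normC_ge0 andbT eq_sym; apply/eqP => /Normc.eq0_normc h0.
  by have := lead_coef_eq0 p; rewrite lead_coefE sn /= h0 eqxx -size_poly_eq0 sn.
have S0 : 0 <= S by apply: sumr_ge0 => i _; apply: normC_ge0.
have K0 : 0 <= K by apply: le_trans (h 0 (lexx _)); apply: normC_ge0.
have key t : 1 <= t -> normC p`_n.+1 * t <= S + K.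
  move=> t1; have t0 : 0 <= t by exact: le_trans t1.
  have tn : 1 <= t ^+ n by exact: exprn_ege1.
  have e : p.[t%:C%C] = \sum_(i < n.+1) p`_i * t%:C%C ^+ i + p`_n.+1 * t%:C%C ^+ n.+1.
    by rewrite horner_coef sn big_ord_recr.
  have h1 : normC (p`_n.+1 * t%:C%C ^+ n.+1) <= K + S * t ^+ n.
    have -> : p`_n.+1 * t%:C%C ^+ n.+1 = p.[t%:C%C] - \sum_(i < n.+1) p`_i * t%:C%C ^+ i.
      by rewrite e addrC addKr.
    apply: le_trans (normCB _ _) _; apply: lerD; first exact: h.
    apply: le_trans (normC_sum n.+1 (fun i => p`_i * t%:C%C ^+ i)) _; rewrite mulr_suml; apply: ler_sum => i _.
    rewrite normCM normCX normC_real ger0_norm // ler_wpM2l ?normC_ge0 //.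
    by apply: ler_weXn2l => //; rewrite -ltnS.
  have h2 : normC p`_n.+1 * t * t ^+ n <= (S + K) * t ^+ n.
    rewrite -mulrA -exprS; have := h1; rewrite normCM normCX normC_real ger0_norm //.
    by move=> /le_trans -> //; rewrite mulrDl addrC lerD2l ler_peMr.
  by rewrite -(ler_pM2r (lt_le_trans ltr01 tn)).
pose t := (S + K) / normC p`_n.+1 + 1.
have t1 : 1 <= t by rewrite lerDr divr_ge0 ?addr_ge0 ?normC_ge0.
have := key t t1; rewrite /t mulrDr mulrCA divff ?gt_eqF // !mulr1; lra.
Qed.

(** Composition with the affine parametrization i X + tau of the ray preserves the degree, so p is
    constant, and its value at 0 is 0. *)
Lemma poly_ray_bounded tau (p : {poly C}) K : p.[0] = 0 ->
  (forall t, 0 <= t -> normC p.[ray tau t] <= K) -> p = 0.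
Proof.
move=> p0 h; pose q : {poly C} := 'i%C *: 'X + tau%:P.
have sq : size q = 2%N.
  by rewrite size_polyDl size_scale ?size_polyX ?neq0Ci // ?size_polyC; case: eqP.
have : (size (p \Po q) <= 1)%N.
  apply: (@poly_bounded_const _ K) => t t0; rewrite horner_comp.
  suff -> : q.[t%:C%C] = ray tau t by exact: h.
  by rewrite /q !hornerE /ray mulrC addrC.
move=> s1; have := size_comp_poly p q; rewrite sq muln1 => e.
have s2 : (size p <= 1)%N.
  by move: s1 e; case: (size (p \Po q)) => [|[]] // _; case: (size p) => [|[]].
by have := size1_polyC s2; rewrite -horner_coef0 p0 => ->; rewrite polyC0.
Qed.

End Ray.

(** * Real calculus on the half-line and on the unit segment *)

Section HalfLine.
Context (R : realType).
Local Notation C := R[i].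
Implicit Types (h H : R -> R) (t : R).

Lemma cvgy0_bound H K : (forall t, 0 <= t -> `|H t| * (1 + t) <= K) ->
  H t @[t --> +oo] --> 0.
Proof.
move=> hK; apply/cvgrPdist_lt => e e0; near=> t.
have t0 : 0 <= t by near: t; apply: nbhs_pinfty_ge; rewrite num_real.
have tK : K / e < t by near: t; apply: nbhs_pinfty_gt; rewrite num_real.
rewrite sub0r normrN; have := hK t t0; move: tK; rewrite ltr_pdivrMr // => h1 h2.
have := normr_ge0 (H t); nra.
Unshelve. all: by end_near.
Qed.

Lemma is_derive_continuous H t l : is_derive t 1 H l -> {for t, continuous H}.
Proof.
by case=> d _; apply: differentiable_continuous; apply/derivable1_diffP.
Qed.

Lemma ge0_FTC_halfline h H :
  (forall t, 0 <= t -> 0 <= h t) ->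
  (forall t, 0 <= t -> {for t, continuous h}) ->
  (forall t, 0 <= t -> is_derive t 1 H (h t)) ->
  H t @[t --> +oo] --> 0 ->
  \int[lebesgue_measure]_(t in `[0%R, +oo[) h t = - H 0 /\
  lebesgue_measure.-integrable `[0%R, +oo[ (EFin \o h).
Proof.
move=> h0 hc hd hl.
have cw : {within `[0, +oo[, continuous h}.
  apply: continuous_in_subspaceT => t; rewrite inE /= in_itv /= andbT; exact: hc.
have d1 t : 0 < t -> derivable H t 1 by move=> /ltW /hd [].
have d2 : H t @[t --> 0^'+] --> H 0.
  by apply: cvg_at_right_filter; apply: (is_derive_continuous (hd 0 _)).
have d3 : {in `]0, +oo[, H^`()%classic =1 h}.
  move=> t; rewrite in_itv /= andbT => /ltW /hd [_ e].
  by rewrite derive1E e.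
split; first by rewrite (Rintegral_ge0_continuous_FTC2y h0 cw hl d1 d2 d3) sub0r.
apply/integrableP; split.
  by apply/measurable_EFinP; apply: subspace_continuous_measurable_fun.
under eq_integral => t.
  rewrite inE /= in_itv /= andbT => t0; rewrite ger0_norm ?h0 //; over.
by rewrite (ge0_continuous_FTC2y h0 cw hl d1 d2 d3) -EFinB ltry.
Qed.

Lemma inv_antiderivative K t : 0 <= t ->
  is_derive t 1 (fun s : R => - (K * (1 + s)^-1)) (K * (1 + t) ^- 2).
Proof.
move=> t0; have n0 : 1 + t != 0 by rewrite gt_eqF // ltr_pwDl.
have d1 : is_derive t 1 (fun s : R => 1 + s) (1 : R).
  by rewrite -[X in is_derive _ _ _ X]add0r; apply: is_deriveD.
have d2 := @is_deriveV R _ _ _ _ n0 d1.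
have d3 := is_deriveZ (- K) d2.
have -> : (fun s : R => - (K * (1 + s)^-1)) = (- K) \*: (fun s => (1 + s)^-1).
  by apply/funext => s /=; rewrite -[_ *: _]/(_ * _) mulNr.
by move: d3; rewrite -[_ *: (_ *: _)]/(_ * (_ * _)) mulr1 mulrNN.
Qed.

(** With k = K (1 + t)^(-2), both k and h + k are nonnegative, which gives their integrability
    together with the value of their integrals; subtraction gives h without a sign condition. *)
Lemma FTC_halfline h H K :
  (forall t, 0 <= t -> {for t, continuous h}) ->
  (forall t, 0 <= t -> is_derive t 1 H (h t)) ->
  (forall t, 0 <= t -> `|h t| * (1 + t) ^+ 2 <= K) ->
  H t @[t --> +oo] --> 0 ->
  \int[lebesgue_measure]_(t in `[0%R, +oo[) h t = - H 0.
Proof.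
move=> hc hd hK hl; pose k t := K * (1 + t) ^- 2.
have p1 t : 0 <= t -> 0 < 1 + t by move=> t0; rewrite ltr_pwDl.
have K0 : 0 <= K by apply: le_trans (hK 0 (lexx _)); rewrite mulr_ge0 // exprn_ge0 ?addr0.
have kc t : 0 <= t -> {for t, continuous k}.
  move=> t0; apply: cvgM; first exact: cvg_cst.
  apply: cvgV; first by rewrite expf_neq0 // gt_eqF // p1.
  have c1 : (1 + s) @[s --> t] --> 1 + t by apply: cvgD; [exact: cvg_cst|exact: cvg_id].
  by rewrite expr2; under eq_cvg do rewrite expr2; exact: (cvgM c1 c1).
have kl : - (K * (1 + t)^-1) @[t --> +oo] --> 0.
  apply: (@cvgy0_bound _ K) => t t0.
  by rewrite normrN ger0_norm ?divr_ge0 ?(ltW (p1 t t0)) // divfK // gt_eqF // p1.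
have [i1 j1] : \int[lebesgue_measure]_(t in `[0%R, +oo[) k t = - - (K * (1 + 0)^-1) /\
  lebesgue_measure.-integrable `[0%R, +oo[ (EFin \o k).
  apply: (@ge0_FTC_halfline k (fun t => - (K * (1 + t)^-1))) => //.
    by move=> t t0; rewrite mulr_ge0 // invr_ge0 exprn_ge0 // ltW // p1.
  by move=> t t0; apply: inv_antiderivative.
have [i2 j2] : \int[lebesgue_measure]_(t in `[0%R, +oo[) (h t + k t) =
    - (H 0 - (K * (1 + 0)^-1)) /\
  lebesgue_measure.-integrable `[0%R, +oo[ (EFin \o (fun t => h t + k t)).
  apply: (@ge0_FTC_halfline (fun t => h t + k t) (fun t => H t - (K * (1 + t)^-1))) => //.
  - move=> t t0; have pt : 0 < (1 + t) ^+ 2 by rewrite exprn_gt0 // p1.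
    have := hK t t0; rewrite -ler_pdivlMr // -/(k t) ler_norml => /andP[h1 _].
    by rewrite -lerBlDr sub0r.
  - by move=> t t0; apply: cvgD; [exact: hc|exact: kc].
  - by move=> t t0; apply: is_deriveD; [exact: hd|exact: inv_antiderivative].
  - by rewrite -[X in _ --> X](addr0 0); apply: cvgD.
have := RintegralB _ j2 j1.
under [X in X = _]eq_Rintegral do rewrite addrK.
move=> -> //; rewrite i1 i2; ring.
Qed.

Lemma FTC_segment h H :
  (forall t, {for t, continuous h}) -> (forall t, is_derive t 1 H (h t)) ->
  \int[lebesgue_measure]_(t in `[0%R, 1%R]) h t = H 1 - H 0.
Proof.
move=> hc hd; rewrite /Rintegral (continuous_FTC2 (F := H)) //.
- by apply: continuous_subspaceT => t; exact: hc.
- split=> [t _||]; first by case: (hd t).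
  + by apply: cvg_at_right_filter; apply: (is_derive_continuous (hd 0)).
  + by apply: cvg_at_left_filter; apply: (is_derive_continuous (hd 1)).
- by move=> t _; rewrite derive1E; case: (hd t).
Qed.

Lemma derive_le0_nonincreasing h H t :
  (forall s : R, 0 <= s -> is_derive s 1 H (h s)) -> (forall s, 0 <= s -> h s <= 0) ->
  0 <= t -> H t <= H 0.
Proof.
move=> hd h0 t0.
have [|||c] := @MVT_segment R H h 0 t => //.
- by move=> s; rewrite in_itv /= => /andP[/ltW s0 _]; exact: hd.
- apply: continuous_in_subspaceT => s; rewrite inE /= in_itv /= => /andP[s0 _].
  exact: is_derive_continuous (hd s s0).
- rewrite in_itv /= => /andP[c0 _] e; rewrite -subr_le0 e subr0.
  by rewrite mulr_le0_ge0 // h0.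
Qed.

(** Both H + K / (1 + t) and - H + K / (1 + t) are nonincreasing, which bounds H by |H 0| + K
    without any integration. *)
Lemma derive_bounded h H K :
  (forall s : R, 0 <= s -> is_derive s 1 H (h s)) ->
  (forall s : R, 0 <= s -> `|h s| * (1 + s) ^+ 2 <= K) ->
  exists L, forall t, 0 <= t -> `|H t| <= L.
Proof.
move=> hd hK.
have K0 : 0 <= K by apply: le_trans (hK 0 (lexx _)); rewrite mulr_ge0 // exprn_ge0 ?addr0.
have key (s : R) : 0 <= s -> `|h s| <= K * (1 + s) ^- 2.
  by move=> s0; rewrite ler_pdivlMr ?hK // exprn_gt0 // ltr_pwDl.
have pos t : 0 <= t -> 0 <= K * (1 + t)^-1.
  by move=> t0; rewrite divr_ge0 // addr_ge0.
exists (`|H 0| + K) => t t0; rewrite ler_norml; apply/andP; split.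
  have h1 : - H t - - (K * (1 + t)^-1) <= - H 0 - - (K * (1 + 0)^-1).
    apply: (@derive_le0_nonincreasing (fun s => - h s - K * (1 + s) ^- 2)
      (fun s => - H s - - (K * (1 + s)^-1))) => // s s0.
      by apply: is_deriveB; [apply: is_deriveN; exact: hd | exact: inv_antiderivative].
    have := key s s0; rewrite ler_norml => /andP[+ _]; lra.
  move: h1; rewrite addr0 invr1 mulr1; have := pos t t0; have := ler_norm (- H 0).
  rewrite normrN; lra.
have h1 : H t - - (K * (1 + t)^-1) <= H 0 - - (K * (1 + 0)^-1).
  apply: (@derive_le0_nonincreasing (fun s => h s - K * (1 + s) ^- 2)
    (fun s => H s - - (K * (1 + s)^-1))) => // s s0.
    by apply: is_deriveB; [exact: hd | exact: inv_antiderivative].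
  have := key s s0; rewrite ler_norml => /andP[_]; lra.
move: h1; rewrite addr0 invr1 mulr1; have := pos t t0; have := ler_norm (H 0); lra.
Qed.

End HalfLine.

(** * Complex-valued curves: derivatives, integrals, vanishing at the cusp *)

Section ComplexCurves.
Context (R : realType).
Local Notation C := R[i].
Implicit Types (f F : R -> C) (g : C -> C) (t : R) (z : C).

(** Componentwise, so that the mean value theorem and the fundamental theorem of calculus apply to
    each part. *)
Definition cder F t (l : C) :=
  is_derive t (1 : R) (fun s => complex.Re (F s)) (complex.Re l) /\
  is_derive t (1 : R) (fun s => complex.Im (F s)) (complex.Im l).

Lemma is_deriveP (K : numFieldType) (V W : normedModType K) (x v : V) (f : V -> W) l :
  is_derive x v f l <-> h^-1 *: (f (h *: v + x) - f x) @[h --> 0^'] --> l.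
Proof.
split=> [[d <-]|h]; first exact: d.
by split; [apply/cvg_ex; exists l | apply: cvg_lim].
Qed.

(** The complex difference quotient is sampled at the increments h b, which tend to 0 without
    vanishing since b is nonzero; multiplying by b turns 1 / (h b) into the real factor 1 / h. *)
Lemma cder_line (a b : C) g t l : b != 0 ->
  is_derive (a + t%:C%C * b : C^o) 1 (g : C^o -> C^o) (l : C^o) ->
  cder (fun s => g (a + s%:C%C * b)) t (l * b).
Proof.
move=> b0 /is_deriveP hd; set x := a + t%:C%C * b.
have key : (((h : R)^-1)%:C%C * (g (a + (h + t)%:C%C * b) - g x) : C^o)
    @[h --> (0 : R)^'] --> (b * l : C^o).
  have bn : 0 < normC b.
    by rewrite lt_neqAle normC_ge0 andbT eq_sym; apply: contra_neq b0 => /Normc.eq0_normc.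
  have lim1 : ((h%:C%C * b : C^o)) @[h --> (0 : R)^'] --> ((0 : C^o)^').
    move=> A /= [e e0 hA]; rewrite /= in e0.
    have [r r0 er] : exists2 r : R, 0 < r & e = r%:C%C.
      exists (complex.Re e); first by move: e0; rewrite ltcE /= => /andP[].
      by move: e0; rewrite ltcE /= => /andP[/eqP Ie _]; apply/eqP; rewrite eq_complex /= Ie !eqxx.
    exists (r / normC b) => /=; first by rewrite divr_gt0.
    move=> h /=; rewrite sub0r normrN => hh h0; apply: hA => /=.
      rewrite sub0r normrN normC_norm er ltcR normCM normC_real.
      by rewrite -ltr_pdivlMr.
    by rewrite mulf_neq0 // (inj_eq (@complexI R)).
  have k0 : (b * ((h%:C%C * b)^-1 * (g (h%:C%C * b * 1 + x) - g x)) : C^o)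
      @[h --> (0 : R)^'] --> (b * l : C^o).
    by apply: cvgCZ; exact: (cvg_comp _ _ lim1 hd).
  apply: cvg_trans k0; apply: near_eq_cvg.
  near=> h; have h0 : h != 0 by near: h; exact: nbhs_dnbhs_neq.
  rewrite /= mulr1 invfM mulrA.
  have -> : a + (h + t)%:C%C * b = h%:C%C * b + x by rewrite /x rmorphD /= mulrDl addrCA addrA.
  congr (_ * _); rewrite mulrCA mulfV // mulr1.
  by rewrite -[RHS]/(real_complex R h^-1) fmorphV.
have ReZ (c : R) (w : C) : complex.Re (c%:C%C * w) = c * complex.Re w.
  by case: w => p q /=; ring.
have ImZ (c : R) (w : C) : complex.Im (c%:C%C * w) = c * complex.Im w.
  by case: w => p q /=; ring.
move/cvgC_comp: key => [k1 k2]; rewrite mulrC; split; apply/is_deriveP.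
  apply: cvg_trans k1; apply: near_eq_cvg; near=> h.
  by rewrite ReZ ReD ReN -[_ *: (1 : R)]/(_ * 1) mulr1.
apply: cvg_trans k2; apply: near_eq_cvg; near=> h.
by rewrite ImZ ImD ImN -[_ *: (1 : R)]/(_ * 1) mulr1.
Unshelve. all: by end_near.
Qed.

Lemma cvgC_mul (T : Type) (G : set_system T) (FG : Filter G) (u v : T -> C) a b :
  ((u x : C^o) @[x --> G] --> (a : C^o)) -> ((v x : C^o) @[x --> G] --> (b : C^o)) ->
  ((u x * v x : C^o) @[x --> G] --> (a * b : C^o)).
Proof.
have ReM (x y : C) : complex.Re (x * y) = complex.Re x * complex.Re y - complex.Im x * complex.Im y.
  by case: x; case: y.
have ImM (x y : C) : complex.Im (x * y) = complex.Re x * complex.Im y + complex.Im x * complex.Re y.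
  by case: x => p q; case: y => r s /=; ring.
move=> /cvgC_comp [h1 h2] /cvgC_comp [k1 k2]; apply/cvgC_comp.
rewrite ReM ImM; split.
  by under eq_cvg do rewrite ReM; apply: cvgB; exact: cvgM.
by under eq_cvg do rewrite ImM; apply: cvgD; exact: cvgM.
Qed.

Definition ccont f t := (f s : C^o) @[s --> t] --> (f t : C^o).

Lemma ccontM f F t : ccont f t -> ccont F t -> ccont (fun s => f s * F s) t.
Proof. exact: cvgC_mul. Qed.

Lemma ccontD f F t : ccont f t -> ccont F t -> ccont (fun s => f s + F s) t.
Proof. exact: cvgCD. Qed.

Lemma ccont_cst a t : ccont (fun=> a) t.
Proof. exact: cvg_cst. Qed.

Lemma ccont_line a b t : ccont (fun s => a + s%:C%C * b) t.
Proof.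
apply/cvgC_dist => e e0.
have b0 : 0 < normC b + 1 by rewrite ltr_pwDr // normC_ge0.
near=> s.
have -> : a + t%:C%C * b - (a + s%:C%C * b) = (t - s)%:C%C * b.
  by rewrite rmorphB /=; ring.
rewrite normCM normC_real.
have hs : `|t - s| < e / (normC b + 1).
  by near: s; apply/nbhs_ballP; exists (e / (normC b + 1)) => //=; exact: divr_gt0.
move: hs; rewrite ltr_pdivlMr // => hs; apply: le_lt_trans hs.
by rewrite ler_wpM2l // lerDl.
Unshelve. all: by end_near.
Qed.

Lemma ccont_horner (p : {poly C}) f t : ccont f t -> ccont (fun s => p.[f s]) t.
Proof.
move=> hf; elim/poly_ind: p => [|p c IH].
  by rewrite (_ : (fun s => _) = fun=> 0); [exact: ccont_cst|apply/funext => s; rewrite horner0].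
rewrite (_ : (fun s => _) = fun s => p.[f s] * f s + c); last first.
  by apply/funext => s; rewrite hornerMXaddC.
exact: (@ccontD (fun s => p.[f s] * f s) (fun=> c) t (ccontM IH hf) (@ccont_cst c t)).
Qed.

Lemma is_derive_horner (p : {poly C}) z :
  is_derive (z : C^o) 1 (horner p : C^o -> C^o) (p^`().[z] : C^o).
Proof.
elim/poly_ind: p => [|p c IH].
  rewrite (_ : horner 0 = fun=> 0); last by apply/funext => x; rewrite horner0.
  by rewrite deriv0 horner0; exact: is_derive_cst.
have -> : (horner (p * 'X + c%:P) : C^o -> C^o) = (horner p : C^o -> C^o) * id + cst c.
  by apply/funext => x; rewrite hornerMXaddC.
have := is_deriveD (is_deriveM IH (is_derive_id (z : C^o) 1)) (is_derive_cst (c : C^o) (z : C^o) 1).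
congr (is_derive _ _ _ _).
by rewrite derivMXaddC !hornerE /= -![_ *: _]/(_ * _) mulr1 (mulrC z).
Qed.

Lemma Cintegral_segment F f :
  (forall t, cder F t (f t)) -> (forall t, ccont f t) ->
  Cintegral `[0%R, 1%R]%classic f = F 1 - F 0.
Proof.
move=> hd hc; rewrite /Cintegral.
have e1 := @FTC_segment R (fun t => complex.Re (f t)) (fun t => complex.Re (F t))
  (fun t => proj1 (proj1 (cvgC_comp _ _ _) (hc t))) (fun t => proj1 (hd t)).
have e2 := @FTC_segment R (fun t => complex.Im (f t)) (fun t => complex.Im (F t))
  (fun t => proj2 (proj1 (cvgC_comp _ _ _) (hc t))) (fun t => proj2 (hd t)).
by rewrite e1 e2; case: (F 1) => a b; case: (F 0).
Qed.

Lemma rapid_cvg0 F : rapid F -> (complex.Re (F t) @[t --> +oo] --> 0) /\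
  (complex.Im (F t) @[t --> +oo] --> 0).
Proof.
move=> /(_ 1%N) [K hK]; split; apply: (@cvgy0_bound _ _ K) => t t0.
  apply: le_trans (hK t t0); rewrite expr1 ler_wpM2r ?normC_re //.
  by rewrite addr_ge0.
apply: le_trans (hK t t0); rewrite expr1 ler_wpM2r ?normC_im //.
by rewrite addr_ge0.
Qed.

Lemma Cintegral_halfline F f :
  (forall t, 0 <= t -> cder F t (f t)) -> (forall t, 0 <= t -> ccont f t) ->
  rapid f -> rapid F ->
  Cintegral `[0%R, +oo[%classic f = - F 0.
Proof.
move=> hd hc rf /rapid_cvg0 [l1 l2]; rewrite /Cintegral.
have [K hK] := rf 2%N.
have bound (u v : R) : `|u| <= v -> forall t, 0 <= t -> `|u| * (1 + t) ^+ 2 <= v * (1 + t) ^+ 2.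
  by move=> uv t t0; rewrite ler_wpM2r // exprn_ge0 // addr_ge0.
have e1 : \int[lebesgue_measure]_(t in `[0, +oo[) complex.Re (f t) = - complex.Re (F 0).
  apply: (@FTC_halfline R _ (fun t => complex.Re (F t)) K) _ _ _ l1 => t t0.
  - by have /cvgC_comp[] := hc t t0.
  - by case: (hd t t0).
  - exact: le_trans (bound _ _ (normC_re _) t t0) (hK t t0).
have e2 : \int[lebesgue_measure]_(t in `[0, +oo[) complex.Im (f t) = - complex.Im (F 0).
  apply: (@FTC_halfline R _ (fun t => complex.Im (F t)) K) _ _ _ l2 => t t0.
  - by have /cvgC_comp[] := hc t t0.
  - by case: (hd t t0).
  - exact: le_trans (bound _ _ (normC_im _) t t0) (hK t t0).
by rewrite e1 e2; case: (F 0).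
Qed.

(* A function with rapidly decreasing derivative is bounded along the ray, so
   its polynomial part is constant. *)
Lemma asym_rapid tau g (g' : R -> C) : asym tau g ->
  (forall t, 0 <= t -> cder (fun s => g (ray tau s)) t (g' t)) -> rapid g' ->
  rapid (fun t => g (ray tau t)).
Proof.
move=> [p [p0 hp]] hd hg.
have [K hK] := hg 2%N.
have [L1 hL1] : exists L, forall t, 0 <= t -> `|complex.Re (g (ray tau t))| <= L.
  apply: (@derive_bounded _ (fun t => complex.Re (g' t)) _ K).
    by move=> t t0; case: (hd t t0).
  move=> t t0; apply: le_trans (hK t t0); rewrite ler_wpM2r ?normC_re //.
  by rewrite exprn_ge0 // addr_ge0.
have [L2 hL2] : exists L, forall t, 0 <= t -> `|complex.Im (g (ray tau t))| <= L.
  apply: (@derive_bounded _ (fun t => complex.Im (g' t)) _ K).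
    by move=> t t0; case: (hd t t0).
  move=> t t0; apply: le_trans (hK t t0); rewrite ler_wpM2r ?normC_im //.
  by rewrite exprn_ge0 // addr_ge0.
have [K1 hK1] := hp 0%N.
have pz : p = 0.
  apply: (@poly_ray_bounded _ tau _ (L1 + L2 + K1)) => // t t0.
  have -> : p.[ray tau t] = g (ray tau t) - (g (ray tau t) - p.[ray tau t]) by ring.
  apply: le_trans (normCB _ _) _; apply: lerD.
    by apply: le_trans (normC_le _) _; apply: lerD; [exact: hL1|exact: hL2].
  by have := hK1 t t0; rewrite expr0 mulr1.
by apply: eq_rapid hp => t _; rewrite pz horner0 subr0.
Qed.

(** The zero derivative is rapidly decreasing, hence so is g along the ray by [asym_rapid]; but g is
    constant there, and a rapidly decreasing constant is 0. *)
Lemma asym_derive0 tau g : asym tau g ->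
  (forall t, 0 <= t -> cder (fun s => g (ray tau s)) t 0) -> g tau = 0.
Proof.
move=> ha hd; have [K hK] := asym_rapid ha hd (@rapid0 R) 1%N.
have cst_re t : 0 <= t -> complex.Re (g (ray tau t)) = complex.Re (g tau).
  move=> t0; apply/eqP; rewrite eq_le; apply/andP; split.
    have := @derive_le0_nonincreasing R (fun=> 0) (fun t => complex.Re (g (ray tau t))) t.
    by rewrite ray0; apply=> // s s0; case: (hd s s0).
  have := @derive_le0_nonincreasing R (fun=> - 0) (fun t => - complex.Re (g (ray tau t))) t.
  rewrite ray0 lerN2; apply=> // s s0.
  by apply: is_deriveN; case: (hd s s0).
have cst_im t : 0 <= t -> complex.Im (g (ray tau t)) = complex.Im (g tau).
  move=> t0; apply/eqP; rewrite eq_le; apply/andP; split.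
    have := @derive_le0_nonincreasing R (fun=> 0) (fun t => complex.Im (g (ray tau t))) t.
    by rewrite ray0; apply=> // s s0; case: (hd s s0).
  have := @derive_le0_nonincreasing R (fun=> - 0) (fun t => - complex.Im (g (ray tau t))) t.
  rewrite ray0 lerN2; apply=> // s s0.
  by apply: is_deriveN; case: (hd s s0).
have cst t : 0 <= t -> g (ray tau t) = g tau.
  by move=> t0; apply/eqP; rewrite eq_complex cst_re // cst_im // !eqxx.
apply: Normc.eq0_normc; apply/eqP; rewrite eq_le normC_ge0 andbT leNgt; apply/negP => n0.
have K0 : 0 <= K.
  by apply: le_trans (hK 0 (lexx _)); rewrite mulr_ge0 ?normC_ge0 // expr1 addr0.
have t0 : 0 <= K / normC (g tau) by rewrite divr_ge0 // ltW.
have := hK _ t0; rewrite cst // expr1 mulrDr mulr1 mulrCA divff ?gt_eqF // mulr1.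
by move: n0; lra.
Qed.

End ComplexCurves.

(** * Eisenstein series, iterated integrals near the cusp, and the shuffle relation *)

Section EisensteinIntegrals.
Context (R : realType).
Local Notation C := R[i].
Implicit Types (tau z : C) (k m n : nat) (t s : R).

Lemma sigma_le m n : (0 < n)%N -> (sigma m n <= n ^ m.+1)%N.
Proof.
case: n => // n _.
have sz : (size (divisors n.+1) <= n.+1)%N.
  rewrite -[X in (_ <= X)%N](size_iota 1); apply: uniq_leq_size; first exact: divisors_uniq.
  move=> d; rewrite -dvdn_divisors // mem_iota => dn.
  by rewrite (dvdn_gt0 _ dn) //= add1n ltnS dvdn_leq.
apply: (@leq_trans (\sum_(d <- divisors n.+1) n.+1 ^ m)).
  rewrite /sigma big_seq [X in (_ <= X)%N]big_seq; apply: leq_sum => d.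
  by rewrite -dvdn_divisors // => /dvdn_leq dn; case: m => [|m]; rewrite ?expn0 // leq_exp2r // dn.
by rewrite big_const_seq count_predT iter_addn_0 expnSr leq_mul2l sz orbT.
Qed.

Lemma coef_bounded_pow M (rho : R) : 0 <= rho < 1 ->
  coef_bounded (fun n => (n%:R : C) ^+ M) rho.
Proof.
elim: M rho => [|M IH] rho /andP[h0 h1].
  exists 1 => n; rewrite expr0 Normc.normc1 mul1r exprn_ile1 // ltW //.
have hm : 0 <= (rho + 1) / 2 < 1 by apply/andP; split; lra.
have hr : 0 <= rho < (rho + 1) / 2 by rewrite h0 /=; lra.
have [K hK] := coef_bounded_natmul hr (IH _ hm).
by exists K => n; have := hK n; rewrite -exprS.
Qed.

(* The q-expansion of G_{2k}; the index is halved as in [eisenstein]. *)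
Definition eis_qcoef k n : C :=
  if n == 0%N then eis0 R k else (sigma (2 * k - 1) n)%:R.

Lemma eis_qcoef_bounded k (rho : R) : 0 <= rho < 1 -> coef_bounded (eis_qcoef k) rho.
Proof.
move=> hr; have [K hK] := coef_bounded_pow (2 * k - 1).+1 hr.
have [h0 _] := andP hr.
exists (normC (eis0 R k) + K) => -[|n].
  have := hK 0%N; rewrite mulr0n exprS mul0r Normc.normc0 mul0r expr0 mulr1 => K0.
  by rewrite lerDl.
have := hK n.+1; rewrite -natrX !normC_nat => /(le_trans _) hh.
apply: (@le_trans _ _ K); last first.
  by rewrite lerDr normC_ge0.
by apply: hh; rewrite ler_wpM2r ?exprn_ge0 // ler_nat sigma_le.
Qed.

Lemma normC_qexp_lt1 tau : upper_half tau -> 0 <= normC (qexp tau) < 1.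
Proof.
move=> h; rewrite normC_ge0 normC_qexp expR_lt1 oppr_lt0 !mulr_gt0 //.
exact: pi_gt0.
Qed.

Lemma eisenstein_qser k tau : (0 < k)%N -> upper_half tau ->
  eisenstein k tau = qser (eis_qcoef k) (qexp tau).
Proof.
move=> k0 h; have /andP[q0 q1] := normC_qexp_lt1 h.
have hr : 0 <= (normC (qexp tau) + 1) / 2 < 1 by apply/andP; split; lra.
have hq : normC (qexp tau) < (normC (qexp tau) + 1) / 2 by lra.
have hc := qser_tail_cvg hq (eis_qcoef_bounded k hr).
rewrite /eisenstein gtn_eqF //.
rewrite [X in _ + X](_ : _ = qser (eis_qcoef k) (qexp tau) - eis0 R k); first by rewrite addrC subrK.
by rewrite -[RHS](cvg_lim _ hc).
Qed.

Lemma rapid_eisenstein k tau : (0 < k)%N -> upper_half tau ->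
  rapid (fun t => eisenstein k (ray tau t) - eis0 R k).
Proof.
move=> k0 h; have /andP[q0 q1] := normC_qexp_lt1 h.
have hr : 0 <= (normC (qexp tau) + 1) / 2 < 1 by apply/andP; split; lra.
have hq : normC (qexp tau) < (normC (qexp tau) + 1) / 2 by lra.
apply: eq_rapid (rapid_qser hq (eis_qcoef_bounded k hr)) => t t0.
by rewrite eisenstein_qser //; exact: upper_ray.
Qed.

Lemma ccont_qexp_ray tau t : ccont (fun s => qexp (ray tau s)) t.
Proof.
rewrite (_ : (fun s => _) = fun s => qexp tau * (expR (- (2 * pi * s)))%:C%C); last first.
  by apply/funext => s; rewrite qexp_ray.
rewrite /ccont; apply: cvgCZ; apply/cvgC_comp => /=; split; last exact: cvg_cst.
have -> : (fun s : R => expR (- (2 * pi * s))) = expR \o (fun s => (- (2 * pi)) * s).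
  by apply/funext => s /=; rewrite mulNr.
have h1 : (- (2 * pi) * s) @[s --> t] --> - (2 * pi) * t.
  by apply: cvgM; [exact: cvg_cst | exact: cvg_id].
by rewrite -(mulNr _ t); exact: (cvg_comp _ _ h1 (@continuous_expR R _)).
Qed.

Lemma ccont_eisenstein k tau t : (0 < k)%N -> upper_half tau -> 0 <= t ->
  ccont (fun s => eisenstein k (ray tau s)) t.
Proof.
(* Continuity at t = 0 is two-sided, so the q-series is controlled from the lower point
   [ray tau (- d)], which is still in the upper half-plane. *)
move=> k0 h t0; pose d := complex.Im tau / 2.
have d0 : 0 < d by apply: divr_gt0.
have hd : upper_half (ray tau (- d)).
  by rewrite /upper_half /= Im_ray /d; move: h; rewrite /upper_half /=; lra.
have /andP[q0 q1] := normC_qexp_lt1 hd.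
set r := normC (qexp (ray tau (- d))) in q0 q1.
have hr : 0 <= (r + 1) / 2 < 1 by apply/andP; split; lra.
have hq : 0 <= r < (r + 1) / 2 by rewrite q0 /=; lra.
have [K hK] := qser_lipschitz hq (eis_qcoef_bounded k hr).
have hs s : - d < s -> upper_half (ray tau s) /\ normC (qexp (ray tau s)) <= r.
  move=> sd; split; first by move: h; rewrite /upper_half /= Im_ray /d in sd *; lra.
  by apply/ltW/normC_qexp_lt; rewrite !Im_ray; lra.
apply/cvgC_dist => e e0.
have K1 : 0 < `|K| + 1 by rewrite ltr_pwDr.
have /cvgC_dist /(_ _ (divr_gt0 e0 K1)) := @ccont_qexp_ray tau t.
have near_d : \forall s \near t, - d < s by apply: lt_nbhsr; lra.
apply: filterS2 near_d => s sd hsq.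
have [u1 n1] := hs _ sd; have [|u2 n2] := hs t; first by lra.
rewrite !eisenstein_qser //; apply: le_lt_trans (hK _ _ n2 n1) _.
move: hsq; rewrite ltr_pdivlMr // mulrC; apply: le_lt_trans.
rewrite ler_wpM2r ?normC_ge0 //; apply: le_trans (ler_norm K) _; lra.
Qed.

Context (G : seq nat -> C -> C) (HG : iterated_eisenstein G).

(** The series of the expansion also converge at a point below tau, where |q| is larger; this bounds
    their coefficients beyond |q(tau)|, and each series differs from its constant term by a rapidly
    decreasing function. The constant terms form the polynomial, and [c 0 0 = 0] makes it vanish at
    0. *)
Lemma asym_iterated k ks tau : upper_half tau -> asym tau (G (k :: ks)).
Proof.
move=> h; have [N [c [c00 hc]]] := iterated_expansion HG k ks.
have h1 : upper_half (ray tau (- (complex.Im tau / 2))).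
  by rewrite /upper_half /= Im_ray; move: h; rewrite /upper_half /=; lra.
have hlt : normC (qexp tau) < normC (qexp (ray tau (- (complex.Im tau / 2)))).
  by apply: normC_qexp_lt; rewrite Im_ray; move: h; rewrite /upper_half /=; lra.
have hb j : (j < N)%N -> coef_bounded (c j) (normC (qexp (ray tau (- (complex.Im tau / 2))))).
  move=> jN; apply: cvg_coef_bounded; first by rewrite normC_qexp expR_gt0.
  by have [] := hc _ h1 => /(_ j jN).
exists (\sum_(j < N) c j 0%N *: 'X^j); split.
  rewrite horner_sum; case: N {hc hb} => [|N]; first by rewrite big_ord0.
  rewrite big_ord_recl big1 ?addr0 => [|i _]; rewrite hornerZ hornerXn.
    by rewrite expr0 c00 mul0r.
  by rewrite expr0n mulr0.
have hj j : (j < N)%N -> rapid (fun t => 'X^j.[ray tau t] *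
    (qser (c j) (qexp (ray tau t)) - c j 0%N)).
  by move=> jN; apply: rapid_horner; exact: rapid_qser hlt (hb j jN).
apply: eq_rapid (rapid_sum hj) => t t0.
have [_ ->] := hc _ (upper_ray h t0).
rewrite horner_sum -sumrB; apply: eq_bigr => j _.
by rewrite hornerZ hornerXn mulrBr (mulrC (c j 0%N)).
Qed.

Definition Gw m k := G (nseq m 0%N ++ [:: k]).

Lemma is_derive_Gw0 k z : upper_half z ->
  is_derive (z : C^o) 1 (Gw 0 k : C^o -> C^o) (- eisenstein k z).
Proof.
by move=> h; have := iterated_derive HG k [::] h; rewrite (iterated_nil HG h) mulr1.
Qed.

Lemma is_derive_G0 ks z : upper_half z ->
  is_derive (z : C^o) 1 (G (0%N :: ks) : C^o -> C^o) (G ks z).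
Proof.
by move=> h; have := iterated_derive HG 0 ks h; rewrite /eisenstein eqxx opprK mul1r.
Qed.

Lemma cder_ray (g : C -> C) tau t l :
  is_derive (ray tau t : C^o) 1 (g : C^o -> C^o) (l : C^o) ->
  cder (fun s => g (ray tau s)) t (l * 'i%C).
Proof. by move=> h; apply: cder_line => //; exact: neq0Ci. Qed.

Lemma holomorphic_derive0 (g : C -> C) tau : asym tau g ->
  (forall t, 0 <= t -> is_derive (ray tau t : C^o) 1 (g : C^o -> C^o) (0 : C^o)) ->
  g tau = 0.
Proof.
move=> ha hd; apply: asym_derive0 ha _ => t t0.
by rewrite -(mul0r 'i%C); apply: cder_ray; exact: hd.
Qed.

Lemma G_0 tau : upper_half tau -> G [:: 0%N] tau = tau.
Proof.
move=> h; suff : G [:: 0%N] tau + (- 'X).[tau] = 0.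
  by move/eqP; rewrite hornerN hornerX subr_eq0 => /eqP.
apply: (@holomorphic_derive0 (fun z => G [:: 0%N] z + (- 'X).[z])).
  by apply: asymD; [exact: asym_iterated | apply: asym_poly; rewrite !hornerE oppr0].
move=> t t0; have u := upper_ray h t0.
have := is_deriveD (is_derive_G0 [::] u) (is_derive_horner (- 'X) (ray tau t)).
by rewrite (iterated_nil HG u) derivN derivX !hornerE /= subrr.
Qed.

(** The multipliers - z and m + 1 are written as values of polynomials, so that [asym_horner] and
    [is_derive_horner] apply to them. *)
Let shuffle_defect m k (z : C) : C := G (nseq m 0%N ++ [:: k; 0%N]) z +
  ((- 'X).[z] * Gw m k z + (m.+1%:R%:P).[z] * Gw m.+1 k z).

Let shuffle_defect_eq0 m k tau : upper_half tau ->
  (forall z, upper_half z ->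
    is_derive (z : C^o) 1 (shuffle_defect m k : C^o -> C^o) (0 : C^o)) ->
  shuffle_defect m k tau = 0.
Proof.
have asymG ks tau' : (0 < size ks)%N -> upper_half tau' -> asym tau' (G ks).
  by case: ks => // a ks _; exact: asym_iterated.
move=> h hd.
have ha : asym tau (shuffle_defect m k).
  apply: asymD; first by apply: asymG => //; rewrite size_cat addnS.
  by apply: asymD; apply: asym_horner; apply: asymG => //; rewrite size_cat addnS.
have hr t : 0 <= t ->
    is_derive (ray tau t : C^o) 1 (shuffle_defect m k : C^o -> C^o) (0 : C^o).
  by move=> t0; apply: hd; exact: upper_ray.
exact: (@holomorphic_derive0 (shuffle_defect m k) tau ha hr).
Qed.

(* Shuffle product of the words (0) and (0, ..., 0, k). *)
Lemma G_0k0 m k tau : upper_half tau ->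
  G (nseq m 0%N ++ [:: k; 0%N]) tau = tau * Gw m k tau - m.+1%:R * Gw m.+1 k tau.
Proof.
have conclude m' z : shuffle_defect m' k z = 0 ->
    G (nseq m' 0%N ++ [:: k; 0%N]) z = z * Gw m' k z - m'.+1%:R * Gw m'.+1 k z.
  move=> hz; apply/eqP; rewrite -subr_eq0 -hz /shuffle_defect hornerN hornerX hornerC.
  by apply/eqP; ring.
elim: m tau => [|m IH] tau h.
  suff hd z : upper_half z ->
      is_derive (z : C^o) 1 (shuffle_defect 0 k : C^o -> C^o) (0 : C^o).
    exact: (conclude _ _ (shuffle_defect_eq0 h hd)).
  move=> u.
  have d1 := iterated_derive HG k [:: 0%N] u.
  have d2 := is_deriveM (is_derive_horner (- 'X) z) (is_derive_Gw0 k u).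
  have d3 := is_deriveM (is_derive_horner (1%:R%:P) z) (is_derive_G0 [:: k] u).
  have := is_deriveD d1 (is_deriveD d2 d3); congr (is_derive _ _ _ _).
  rewrite G_0 // derivN derivX derivC !hornerE /= -![_ *: _]/(_ * _) /Gw /=; ring.
(* The derivative of the defect of index m + 1 is the defect of index m, which vanishes by
   induction. *)
suff hd z : upper_half z ->
    is_derive (z : C^o) 1 (shuffle_defect m.+1 k : C^o -> C^o) (0 : C^o).
  exact: (conclude _ _ (shuffle_defect_eq0 h hd)).
move=> u.
have d1 := is_derive_G0 (nseq m 0%N ++ [:: k; 0%N]) u.
have d2 := is_deriveM (is_derive_horner (- 'X) z) (is_derive_G0 (nseq m 0%N ++ [:: k]) u).
have d3 := is_deriveM (is_derive_horner (m.+2%:R%:P) z) (is_derive_G0 (0%N :: nseq m 0%N ++ [:: k]) u).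
have := is_deriveD d1 (is_deriveD d2 d3); congr (is_derive _ _ _ _).
rewrite derivN derivX derivC !hornerE /= -![_ *: _]/(_ * _).
rewrite IH // /Gw /= -!natr1; ring.
Qed.

End EisensteinIntegrals.

(** * Evaluation of the regularized integral on powers of tau - z *)

Section RegularizedIntegral.
Context (R : realType).
Local Notation C := R[i].
Implicit Types (tau z : C) (k m n : nat) (t s : R).

(* Taylor-type antiderivative: for g_(j+1)' = g_j and g_0' = h its derivative
   is (w - z)^m h, and at z = w it takes the value m! g_m(w). *)
Fixpoint iter_primitive (w : C) m (g : nat -> C -> C) (z : C) : C :=
  if m is m'.+1 then
    ((w%:P - 'X) ^+ m).[z] * g 0%N z +
    m%:R * iter_primitive w m' (fun j => g j.+1) z
  else g 0%N z.

Lemma is_derive_iter_primitive w m (g : nat -> C -> C) (h : C) z :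
  is_derive (z : C^o) 1 (g 0%N : C^o -> C^o) h ->
  (forall j, is_derive (z : C^o) 1 (g j.+1 : C^o -> C^o) (g j z)) ->
  is_derive (z : C^o) 1 (iter_primitive w m g : C^o -> C^o)
    (((w%:P - 'X) ^+ m).[z] * h).
Proof.
elim: m g h => [|m IH] g h h0 hj.
  by rewrite expr0 hornerE mul1r.
have d1 := is_deriveM (is_derive_horner ((w%:P - 'X) ^+ m.+1) z) h0.
have d2 := is_deriveZ (m.+1%:R : C) (IH (fun j => g j.+1) (g 0%N z) (hj 0%N) (fun j => hj j.+1)).
have := is_deriveD d1 d2; congr (is_derive _ _ _ _).
rewrite deriv_exp derivB derivC derivX sub0r hornerMn !hornerE /= -![_ *: _]/(_ * _).
rewrite -[(_ * _) *+ _]mulr_natr; ring.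
Qed.

Lemma iter_primitive_diag w m (g : nat -> C -> C) :
  iter_primitive w m g w = m`!%:R * g m w.
Proof.
elim: m g => [|m IH] g /=; first by rewrite fact0 mul1r.
by rewrite IH horner_exp hornerD hornerN hornerC hornerX subrr exprS !mul0r add0r mulrA -natrM factS.
Qed.

Lemma rapid_iter_primitive w m (g : nat -> C -> C) tau :
  (forall j, rapid (fun t => g j (ray tau t))) ->
  rapid (fun t => iter_primitive w m g (ray tau t)).
Proof.
elim: m g => [|m IH] g hg /=; first exact: hg.
by apply: rapidD; [exact: rapid_horner | apply: rapidZ; apply: IH].
Qed.

Context (G : seq nat -> C -> C) (HG : iterated_eisenstein G).

(* Iterated primitives of a_0 - G_{2k} that vanish at the cusp. *)
Let cusp_primitive k j (z : C) : C :=
  Gw G j k z + ((eis0 R k / (j.+1)`!%:R) *: 'X^(j.+1)).[z].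

Let is_derive_cusp0 k z : upper_half z ->
  is_derive (z : C^o) 1 (cusp_primitive k 0 : C^o -> C^o) (- (eisenstein k z - eis0 R k)).
Proof.
move=> u; have := is_deriveD (is_derive_Gw0 HG k u)
  (is_derive_horner ((eis0 R k / 1`!%:R) *: 'X^1) z).
congr (is_derive _ _ _ _).
by rewrite derivZ derivXn expr0 mulr1n hornerZ hornerC divr1; ring.
Qed.

Let is_derive_cuspS k j z : upper_half z ->
  is_derive (z : C^o) 1 (cusp_primitive k j.+1 : C^o -> C^o) (cusp_primitive k j z).
Proof.
move=> u; have := is_deriveD (is_derive_G0 HG (nseq j 0%N ++ [:: k]) u)
  (is_derive_horner ((eis0 R k / (j.+2)`!%:R) *: 'X^(j.+2)) z).
congr (is_derive _ _ _ _); rewrite /cusp_primitive /Gw; congr (_ + _).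
rewrite derivZ derivXn /= hornerZ hornerMn !hornerZ !hornerXn -[(_ ^+ _) *+ _]mulr_natr (factS j.+1) natrM.
have h1 : (j.+1)`!%:R != 0 :> C by rewrite pnatr_eq0 -lt0n fact_gt0.
have h2 : j.+2%:R != 0 :> C by rewrite pnatr_eq0.
move: ((j.+1)`!%:R : C) h1 (j.+2%:R : C) h2 => x x0 y y0.
by field; rewrite x0 y0.
Qed.

(** By induction on j: each function has polynomial asymptotics without constant term and its
    derivative is already rapidly decreasing, so [asym_rapid] removes the polynomial. *)
Let rapid_cusp k tau : (0 < k)%N -> upper_half tau -> forall j,
  rapid (fun t => cusp_primitive k j (ray tau t)).
Proof.
move=> k0 h.
have asymG j : asym tau (cusp_primitive k j).
  apply: asymD; first by case: j => [|j]; exact: asym_iterated.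
  by apply: asym_poly; rewrite hornerZ hornerXn exprS mul0r mulr0.
elim=> [|j IH].
  apply: (asym_rapid (asymG 0%N)) => [t t0|].
    apply: cder_ray; apply: is_derive_cusp0; exact: upper_ray.
  apply: eq_rapid (rapidZ (- 'i%C) (rapid_eisenstein k0 h)) => t _; ring.
apply: (asym_rapid (asymG j.+1)) => [t t0|].
  by apply: cder_ray; apply: is_derive_cuspS; exact: upper_ray.
by apply: eq_rapid (rapidZ 'i%C IH) => t _; rewrite mulrC.
Qed.

(** Repeated integration by parts with base point w = tau turns the half-line integral into c m!
    [cusp_primitive k m tau]. This exceeds the wanted value by c a_0 tau^(m+1) / (m+1), which is
    exactly the integral over the segment from 0 to tau. *)
Lemma reg_integral_power k m (c : C) tau : (0 < k)%N -> upper_half tau ->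
  reg_integral k (c *: (tau%:P - 'X) ^+ m) tau = c * (m`!%:R * Gw G m k tau).
Proof.
move=> k0 h; rewrite /reg_integral.
set P := c *: _.
have hn : c *: (tau%:P - 'X) ^+ m = P by [].
have half : Cintegral `[0%R, +oo[%classic (fun t =>
    (eisenstein k (ray tau t) - eis0 R k) * P.[ray tau t] * 'i%C) =
    c * (m`!%:R * cusp_primitive k m tau).
  pose F t := - c * iter_primitive tau m (cusp_primitive k) (ray tau t).
  have -> : c * (m`!%:R * cusp_primitive k m tau) = - F 0.
    by rewrite /F ray0 iter_primitive_diag; ring.
  apply: (@Cintegral_halfline _ F).
  - move=> t t0; have u := upper_ray h t0; apply: (@cder_ray R (fun z => - c * iter_primitive tau m (cusp_primitive k) z)).
    have := is_deriveZ (- c) (is_derive_iter_primitive tau m (is_derive_cusp0 k u)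
      (fun j => is_derive_cuspS k j u)).
    by congr (is_derive _ _ _ _); rewrite -[_ *: _]/(_ * _) /P hornerZ; ring.
  - move=> t t0; apply: ccontM; last exact: ccont_cst.
    apply: ccontM; last by apply: ccont_horner; exact: ccont_line.
    by apply: cvgCB; [exact: ccont_eisenstein | exact: cvg_cst].
  - apply: eq_rapid (rapid_horner tau ('i%C *: P) (rapid_eisenstein k0 h)) => t _.
    by rewrite hornerZ; ring.
  - by apply: rapidZ; apply: rapid_iter_primitive; exact: rapid_cusp.
have seg : Cintegral `[0%R, 1%R]%classic (fun t => eis0 R k * P.[t%:C%C * tau] * tau) =
    c * (eis0 R k * tau ^+ m.+1 / m.+1%:R).
  pose Q : {poly C} := (- (c * eis0 R k / m.+1%:R)) *: (tau%:P - 'X) ^+ m.+1.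
  have t0 : tau != 0.
    by apply: contraTneq h => ->; rewrite /upper_half /= ltxx.
  have m0 : m.+1%:R != 0 :> C by rewrite pnatr_eq0.
  have -> : c * (eis0 R k * tau ^+ m.+1 / m.+1%:R) =
      Q.[0 + 1%:C%C * tau] - Q.[0 + 0%:C%C * tau].
    rewrite rmorph1 rmorph0 mul1r mul0r !add0r /Q !hornerZ !horner_exp.
    rewrite !(hornerD, hornerN, hornerC, hornerX) subrr subr0 [0 ^+ _]exprS mul0r mulr0 sub0r.
    by move: (m.+1%:R : C) m0 => x x0; field.
  apply: (@Cintegral_segment _ (fun t => Q.[0 + t%:C%C * tau])).
  - move=> t; have := cder_line t0 (is_derive_horner Q (0 + t%:C%C * tau)).
    congr (cder _ _ _); congr (_ * _); rewrite add0r.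
    rewrite /Q /P derivZ deriv_exp derivB derivC derivX sub0r !hornerZ hornerMn.
    rewrite !(hornerM, hornerN, hornerC, horner_exp, hornerD, hornerX) -[m.+1.-1]/m.
    rewrite -[(_ * _) *+ _]mulr_natr; move: (m.+1%:R : C) m0 => x x0.
    by field.
  - move=> t; apply: ccontM; last exact: ccont_cst.
    apply: ccontM; first exact: ccont_cst.
    apply: ccont_horner; have := @ccont_line R 0 tau t.
    by congr (ccont _ _); apply/funext => s; rewrite add0r.
rewrite -[X in X - _]/(Cintegral _ (fun t =>
    (eisenstein k (ray tau t) - eis0 R k) * P.[ray tau t] * 'i%C)) half seg.
rewrite /cusp_primitive hornerZ hornerXn factS natrM.
have h1 : m`!%:R != 0 :> C by rewrite pnatr_eq0 -lt0n fact_gt0.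
have h2 : m.+1%:R != 0 :> C by rewrite pnatr_eq0.
move: (m`!%:R : C) h1 (m.+1%:R : C) h2 => x x0 y y0.
by field; rewrite x0 y0.
Qed.

End RegularizedIntegral.

(** * Multiplication by U and V, and powers of a linear form *)

Section PowerSeriesCoefficients.
Context (A : comNzRingType).
Implicit Types (f g : fps2 A) (a b : A).

Lemma fpsZE a f i j : (a *: f) i j = a * f i j. Proof. by []. Qed.
Lemma fpsDE f g i j : (f + g) i j = f i j + g i j. Proof. by []. Qed.
Lemma fpsNE f i j : (- f) i j = - f i j. Proof. by []. Qed.

Lemma fpsUM f i j : (fpsU A * f) i j = if i is i'.+1 then f i' j else 0.
Proof.
rewrite [LHS]/(fps2_mul _ _ _ _) /fps2_mul /fpsU.
case: i => [|i].
  by rewrite big1 // => p _; rewrite big1 // => q _; rewrite (ord1 p) /= mul0r.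
rewrite big_ord_recl big1 ?add0r => [|q _]; last by rewrite /= mul0r.
rewrite big_ord_recl big_ord_recl /= mul1r subn0 subSS subn0 [X in _ + X + _]big1 ?addr0 => [|q _]; last by rewrite /= mul0r.
by rewrite big1 ?addr0 // => p _; rewrite big1 // => q _; rewrite /= mul0r.
Qed.

Lemma fpsVM f i j : (fpsV A * f) i j = if j is j'.+1 then f i j' else 0.
Proof.
rewrite [LHS]/(fps2_mul _ _ _ _) /fps2_mul /fpsV.
rewrite big_ord_recl [X in _ + X]big1 ?addr0 => [|p _]; last first.
  by rewrite big1 // => q _; rewrite /= mul0r.
case: j => [|j]; first by rewrite big1 // => q _; rewrite (ord1 q) /= mul0r.
rewrite big_ord_recl big_ord_recl /= mul0r add0r mul1r subn0 subSS subn0.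
by rewrite big1 ?addr0 // => q _; rewrite /= mul0r.
Qed.

Lemma fps_linearX a b n i j : ((a *: fpsU A + b *: fpsV A) ^+ n : fps2 A) i j =
  if (i + j == n)%N then 'C(n, j)%:R * a ^+ i * b ^+ j else 0.
Proof.
have step f : (a *: fpsU A + b *: fpsV A) * f = a *: (fpsU A * f) + b *: (fpsV A * f).
  apply/funext => i'; apply/funext => j'; rewrite mulrDl !fpsDE.
  rewrite ![(_ * _ : fps2 A) _ _]/(fps2_mul _ _ _ _) !fpsZE !/(fps2_mul _ _ _ _) /fps2_mul.
  by rewrite !mulr_sumr; congr (_ + _); apply: eq_bigr => p _; rewrite mulr_sumr;
    apply: eq_bigr => q _; rewrite fpsZE mulrA.
elim: n i j => [|n IH] i j.
  rewrite expr0 [LHS]/(fps2_one A i j) /fps2_one addn_eq0.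
  by case: i => [|i] //=; case: j => [|j] //=; rewrite !expr0 !mulr1.
rewrite exprS step fpsDE !fpsZE fpsUM fpsVM.
case: i => [|i]; case: j => [|j]; rewrite ?IH ?mulr0 ?add0r ?addr0 //.
- rewrite !add0n eqSS; case: eqP => [->|_]; last by rewrite mulr0.
  by rewrite !binn !expr0 exprS; ring.
- rewrite !addn0 eqSS; case: eqP => [->|_]; last by rewrite mulr0.
  by rewrite !bin0 !expr0 exprS; ring.
- rewrite (addSnnS i j) (addSn i j.+1) eqSS.
  case: eqP => [e|_]; last by rewrite !mulr0 addr0.
  by rewrite binS natrD !exprS; ring.
Qed.

End PowerSeriesCoefficients.

(** * Coefficients of the sum of regularized Eisenstein integrals *)

Section EisensteinSum.
Context (R : realType).
Local Notation C := R[i].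
Implicit Types (tau : C) (i j k : nat).

Lemma twopii_neq0 : twopii R != 0.
Proof.
apply/eqP => /(congr1 (@complex.Im R)) /= /eqP.
by rewrite mulf_eq0 pnatr_eq0 /= gt_eqF // pi_gt0.
Qed.

Lemma WserM tau (f : fps2 C) i j : (Wser tau * f) i j =
  (twopii R)^-1 * (if i is i'.+1 then f i' j else 0) +
  tau * (if j is j'.+1 then f i j' else 0).
Proof.
rewrite -fpsUM -fpsVM /Wser mulrDl fpsDE.
by congr (_ + _); rewrite ![(_ * _ : fps2 C) _ _]/(fps2_mul _ _ _ _) /fps2_mul mulr_sumr;
  apply: eq_bigr => p _; rewrite mulr_sumr; apply: eq_bigr => q _; rewrite fpsZE mulrA.
Qed.

(** Since W - z V = U / (2 pi i) + (tau - z) V, each coefficient is a constant times a power of tau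
    - z, the shape that [reg_integral_power] integrates. *)
Lemma eis_cofactorE k tau i j : eis_cofactor k tau i j =
  (if (i + j == 2 * k - 2)%N then
    twopii R ^+ (2 * k - 1) * 'C(2 * k - 2, j)%:R * (twopii R)^-1 ^+ i else 0)
  *: (tau%:P - 'X) ^+ j.
Proof.
rewrite /eis_cofactor; set W : fps2 {poly C} := fun i j => _.
have -> : W - 'X *: fpsV {poly C} =
    ((twopii R)^-1)%:P *: fpsU {poly C} + (tau%:P - 'X) *: fpsV {poly C}.
  apply/funext => a; apply/funext => b; rewrite !(fpsDE, fpsNE, fpsZE) /W /Wser.
  rewrite fpsDE !fpsZE polyCD !polyCM /fpsU /fpsV !polyC_natr; ring.
rewrite fpsZE fps_linearX; case: eqP => _; last by rewrite mulr0 scale0r.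
rewrite -mul_polyC !polyCM polyC_natr !polyC_exp; ring.
Qed.

Context (G : seq nat -> C -> C) (HG : iterated_eisenstein G).

(** With i + j = 2k - 2, the powers (2 pi i)^(2k-1) and (2 pi i)^(-i) combine to (2 pi i)^(j+1). The
    binomial coefficient times the j! of the integration is a falling factorial, to be matched with
    the iterates of epsilon_0. *)
Lemma eis_integralE k tau i j : (0 < k)%N -> upper_half tau ->
  eis_integral k tau i j = if (i + j == 2 * k - 2)%N then
    twopii R ^+ j.+1 * ((i + j) ^_ j)%:R * Gw G j k tau else 0.
Proof.
move=> k0 h; rewrite /eis_integral eis_cofactorE (reg_integral_power HG) //.
case: eqP => [e|_]; last by rewrite mul0r.
have -> : (2 * k - 1 = j.+1 + i)%N by rewrite addSn addnC e -subSn // leq_pmulr.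
have t0 := twopii_neq0; have ti : twopii R ^+ i != 0 by rewrite expf_neq0.
rewrite -e -bin_ffact natrM exprD exprVn; move: (twopii R ^+ i) ti => x x0; by field; exact: x0.
Qed.

(** By homogeneity a given monomial occurs for at most one k, so the partial sums are eventually
    constant and the limit is the single surviving term. *)
Lemma eis_sumE tau i j : upper_half tau ->
  eis_sum tau i j = if odd (i + j) then 0 else
    let k := (i + j)./2.+1 in
    eis_coef R k * (twopii R ^+ j.+1 * ((i + j) ^_ j)%:R * Gw G j k tau).
Proof.
move=> h; set v := RHS.
suff e N : ((i + j)./2.+1 < N)%N ->
    \sum_(1 <= k < N) eis_coef R k * eis_integral k tau i j = v.
  rewrite /eis_sum; apply: (@cvg_lim C^o) => //.
  apply: cvg_near_cst; near=> N; apply: e.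
  by near: N; exact: nbhs_infty_gt.
move=> hN.
have z k : (0 < k)%N -> (k != (i + j)./2.+1) || odd (i + j) ->
    eis_coef R k * eis_integral k tau i j = 0.
  move=> k0 hk; rewrite eis_integralE //; case: eqP => [e|_]; last by rewrite mulr0.
  have e2 : (i + j = k.-1.*2)%N by rewrite e -mul2n -subn1 mulnBr.
  by move: hk; rewrite e2 odd_double orbF doubleK prednK // eqxx.
rewrite /v; case: ifP => ho.
  by rewrite big_nat big1 // => k /andP[k0 _]; rewrite z // ho orbT.
have e2 : (i + j = 2 * (i + j)./2.+1 - 2)%N.
  by rewrite mulnS addKn mul2n -[LHS]odd_double_half ho.
rewrite (bigD1_seq (i + j)./2.+1) ?mem_index_iota ?iota_uniq //= big1_seq ?addr0.
  by rewrite eis_integralE // -e2 eqxx.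
by move=> k /andP[hk]; rewrite mem_index_iota => /andP[k0 _]; rewrite z // hk.
Unshelve. all: by end_near.
Qed.

End EisensteinSum.

(** * The lower central series and brackets *)

Section LieFiltration.
Context (K : comNzRingType) (L : lieAlgType K).
Implicit Types x y z u v : L.

Lemma lie_der z x y : [lie z, [lie x, y]] = [lie [lie z, x], y] + [lie x, [lie z, y]].
Proof.
have := lie_jacobi z x y; rewrite (lie_antisym y z) lieNr (lie_antisym y [lie z, x]).
by move=> /eqP; rewrite subr_eq0 subr_eq => /eqP.
Qed.

(** Induction on p through [[u, v], y] = [u, [v, y]] - [v, [u, y]]; the extra 1 comes from [lcs 0]
    being the whole algebra. *)
Lemma lcs_lie p q x y : lcs p x -> lcs q y -> lcs (p + q).+1 [lie x, y].
Proof.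
elim: p q x y => [|p IH] q x y; first by move=> _; exact: lcs_lieS.
move=> hx hy; elim: hx => {x} [|x [u [v [_ lv ->]]]|x x' _ h _ h'|c x _ h].
- by rewrite lie0l; exact: lcs0.
- have -> : [lie [lie u, v], y] = [lie u, [lie v, y]] - [lie v, [lie u, y]].
    by rewrite (lie_der u) addrK.
  apply: lcsB; first by apply: lcs_lieS; exact: IH.
  by rewrite addSnnS; apply: IH => //; exact: lcs_lieS.
- by rewrite lieDl; exact: lcsD.
- by rewrite lieZl; exact: lcsZ.
Qed.

End LieFiltration.

(** * Completeness, unordered sums and continuous derivations in the completion *)

Section CompletionTheory.
Context (K : comNzRingType) (L : lieAlgType K).
Local Notation M := (completion L).
Implicit Types (x y z : M) (n : nat).

Lemma cfiltB n x y : cfilt n x -> cfilt n y -> cfilt n (x - y).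
Proof. by move=> hx hy; apply: cfiltD => //; exact: cfiltN. Qed.

Lemma cohseq_stable (u : cohseq L) m n : (m <= n)%N -> lcs m (u n - u m).
Proof.
move=> /subnK <-; elim: (n - m)%N => [|d IH]; first by rewrite subrr; exact: lcs0.
rewrite addSn -(subrK (u (d + m)%N) (u _.+1)) -addrA; apply: lcsD => //.
by apply: (lcs_sub (leq_addl d m)); exact: cohseqP.
Qed.

Lemma cfilt_lie p q x y : cfilt p x -> cfilt q y -> cfilt (p + q).+1 [lie x, y].
Proof.
move=> hx hy; apply/(cfiltE _ (cohseq_br (repr x) (repr y))) => /=.
apply: lcs_lie.
  rewrite -(subrK ((repr x : cohseq L) p) ((repr x : cohseq L) _)); apply: lcsD => //.
  by apply: cohseq_stable; rewrite leqW // leq_addr.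
rewrite -(subrK ((repr y : cohseq L) q) ((repr y : cohseq L) _)); apply: lcsD => //.
by apply: cohseq_stable; rewrite leqW // leq_addl.
Qed.

Lemma cfilt_any x : cfilt 0 x. Proof. by []. Qed.

Lemma cfilt_lier n x y : cfilt n y -> cfilt n [lie x, y].
Proof. by move=> h; apply: (cfilt_sub (leqnSn n)); exact: (cfilt_lie (cfilt_any x) h). Qed.

Lemma cfilt_eq0 x : (forall n, cfilt n x) -> x = 0.
Proof.
move=> h; rewrite -[x]reprK; apply: (@completion_eq _ _ (repr x) 0) => n.
by rewrite subr0; exact: h.
Qed.

(** The limit is represented by the diagonal: its n-th entry is the n-th entry of a representative
    of [u n]. *)
Lemma cfilt_complete (u : nat -> M) : (forall n, cfilt n (u n.+1 - u n)) ->
  exists l, forall n, cfilt n (l - u n).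
Proof.
move=> hu; pose v n : L := (repr (u n) : cohseq L) n.
have subE n x y : cfilt n (x - y) ->
    lcs n ((repr x : cohseq L) n - (repr y : cohseq L) n).
  by rewrite -{1}[x]reprK -{1}[y]reprK quotm_piB => /(cfiltE n (repr x - repr y)).
have cv : v \in @coherent K L.
  apply/asboolP => n; rewrite /v -(subrK ((repr (u n.+1) : cohseq L) n) (_ n.+1)) -addrA.
  by apply: lcsD; [exact: cohseqP | exact: subE].
exists (\pi_(completion L) (CohSeq cv))%qT => n.
rewrite -[u n]reprK quotm_piB; apply/(cfiltE n (CohSeq cv - repr (u n))).
by rewrite (_ : cohval (CohSeq cv - repr (u n)) n = v n - v n) // subrr; exact: lcs0.
Qed.

Lemma completion_hausdorff : hausdorff_space M.
Proof.
move=> p q hpq; apply/eqP; rewrite -subr_eq0; apply/eqP/cfilt_eq0 => n.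
have [||r [h1 h2]] := hpq [set y | cfilt n (y - p)] [set y | cfilt n (y - q)].
- by exists n.
- by exists n.
by rewrite -opprB -(subrK r q) -addrA opprD -opprB opprK; apply: cfiltB; rewrite // -opprB; exact: cfiltN.
Qed.

Section SummableFamily.
Context (I : choiceType) (f : I -> M).

(** The ultrametric criterion: the filtration steps are subgroups of a complete group, so terms
    tending to 0 suffice for unordered convergence. *)
Definition cfilt_summable := forall n, exists s : seq I, forall i, i \notin s -> cfilt n (f i).

Lemma partial_sumE (A : {fset I}) : partial_sum f A = \sum_(i <- A) f i.
Proof. by rewrite /partial_sum big_seq_fsetE. Qed.

(** P stands for a subgroup, later [cfilt n] or [D2n n]. Terms common to A and B cancel, and a term
    of only one of them lies in P because the other leaves it out. *)
Lemma cfilt_sum_diff (P : M -> Prop) (A B : seq I) : P 0 ->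
  (forall x y, P x -> P y -> P (x + y)) -> (forall x, P x -> P (- x)) ->
  uniq A -> uniq B ->
  (forall i, i \notin A -> P (f i)) -> (forall i, i \notin B -> P (f i)) ->
  P (\sum_(i <- A) f i - \sum_(i <- B) f i).
Proof.
move=> P0 PD PN uA uB hA hB.
rewrite (bigID (mem B)) [X in _ - X](bigID (mem A)) /=.
have -> : \sum_(i <- A | i \in B) f i = \sum_(i <- B | i \in A) f i.
  rewrite -[LHS]big_filter -[RHS]big_filter; apply: perm_big.
  by apply: uniq_perm; rewrite ?filter_uniq // => i; rewrite !mem_filter andbC.
rewrite opprD addrACA subrr add0r; apply: (PD); last apply: (PN).
  by apply: (big_ind P) => // i; exact: hB.
by apply: (big_ind P) => // i; exact: hA.
Qed.

Lemma summable_limit : cfilt_summable ->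
  exists2 l, lim (partial_sum f @ totally) = l &
    forall n (s : seq I), uniq s -> (forall i, i \notin s -> cfilt n (f i)) ->
      cfilt n (l - \sum_(i <- s) f i).
Proof.
move=> hf; have [s hs] := choice hf.
pose t n := undup (s n).
have diff n (A B : seq I) : uniq A -> uniq B ->
    (forall i, i \notin A -> cfilt n (f i)) -> (forall i, i \notin B -> cfilt n (f i)) ->
    cfilt n (\sum_(i <- A) f i - \sum_(i <- B) f i).
  apply: cfilt_sum_diff; [exact: cfilt0 | exact: cfiltD | exact: cfiltN].
have ht n i : i \notin t n -> cfilt n (f i) by rewrite mem_undup => /hs.
have [l hl] := @cfilt_complete (fun n => \sum_(i <- t n) f i)
  (fun n => diff n _ _ (undup_uniq _) (undup_uniq _)
    (fun i hi => cfilt_sub (leqnSn n) (ht n.+1 i hi)) (ht n)).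
have key n (A : seq I) : uniq A -> (forall i, i \notin A -> cfilt n (f i)) ->
    cfilt n (l - \sum_(i <- A) f i).
  move=> uA hA; rewrite -(subrK (\sum_(i <- t n) f i) l) -addrA.
  by apply: cfiltD; [exact: hl | apply: diff => //; [exact: undup_uniq | exact: ht]].
exists l => //; apply: (@cvg_lim _ completion_hausdorff _ _ (@totally_filter _)) => U [n hU].
exists [fset i in t n]%fset => // B /= /fsubsetP hB; apply: hU.
rewrite partial_sumE -opprB; apply/cfiltN/key; first exact: fset_uniq.
by move=> i iB; apply: ht; apply: contra iB => it; apply: hB; rewrite inE.
Qed.

End SummableFamily.

Lemma closed_lieP (A B : set M) x :
  closed_lie A B x <-> forall n, exists2 u, lie_set A B u & cfilt n (u - x).
Proof.
rewrite -[closed_lie A B x]/(closure (lie_set A B) x); split=> [h n|h U [n hU]].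
  by have [|u [h1 h2]] := h [set z | cfilt n (z - x)]; [exists n | exists u].
by have [u h1 h2] := h n; exists u; split=> //; exact: hU.
Qed.

Lemma closed_lie_closed (A B : set M) x :
  (forall n, exists2 y, closed_lie A B y & cfilt n (y - x)) -> closed_lie A B x.
Proof.
move=> h; apply/closed_lieP => n; have [y /closed_lieP /(_ n) [u hu uy] hy] := h n.
by exists u => //; rewrite -(subrK y u) -addrA; exact: cfiltD.
Qed.

Lemma closed_lie_gen (A B : set M) x y : A x -> B y -> closed_lie A B [lie x, y].
Proof.
move=> hx hy; apply/closed_lieP => n; exists [lie x, y].
  by apply: lspan_gen; exists x, y.
by rewrite subrr; exact: cfilt0.
Qed.

(** Continuity is expressed through the filtration, in a form shared by the epsilon_{2k} and by the
    inner derivations ad(z). *)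
Record continuous_derivation (e : M -> M) : Prop := {
  contder_lin : forall c x y, e (c *: x + y) = c *: e x + e y;
  contder_leib : forall x y, e [lie x, y] = [lie e x, y] + [lie x, e y];
  contder_cont : forall n, exists m, forall x, cfilt m x -> cfilt n (e x) }.

Section Derivation.
Context (e : M -> M) (he : continuous_derivation e).

Lemma contderD x y : e (x + y) = e x + e y.
Proof. by have := contder_lin he 1 x y; rewrite !scale1r. Qed.

Lemma contderZ c x : e (c *: x) = c *: e x.
Proof.
have e0 : e 0 = 0 by apply: (addrI (e 0)); rewrite -contderD !addr0.
by have := contder_lin he c x 0; rewrite !addr0 e0 addr0.
Qed.

Lemma contder0 : e 0 = 0.
Proof. by have := contderZ 0 0; rewrite !scale0r. Qed.

Lemma contderN x : e (- x) = - e x.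
Proof. by rewrite -scaleN1r contderZ scaleN1r. Qed.

Lemma contderB x y : e (x - y) = e x - e y.
Proof. by rewrite contderD contderN. Qed.

Lemma closed_lie_stable (A B : set M) : (forall x, A x -> A (e x)) ->
  (forall x, B x -> B (e x)) -> forall x, closed_lie A B x -> closed_lie A B (e x).
Proof.
move=> hA hB x /closed_lieP hx; apply/closed_lieP => n.
have [m hm] := contder_cont he n; have [u hu ux] := hx m.
exists (e u); last by rewrite -contderB; exact: hm.
elim: hu {ux} => {u} [|u [v [w [Av Bw ->]]]|u v _ hu _ hv|c u _ hu].
- by rewrite contder0; exact: lspan0.
- by rewrite (contder_leib he); apply: lspanD; apply: lspan_gen;
    [exists (e v), w | exists v, (e w)]; split=> //; [exact: hA | exact: hB].
- by rewrite contderD; exact: lspanD.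
- by rewrite contderZ; exact: lspanZ.
Qed.

End Derivation.

Lemma lie_derivation z : continuous_derivation (fun x => [lie z, x]).
Proof.
split=> [c x y|x y|n]; first by rewrite lieDr lieZr.
  exact: lie_der.
by exists n => x; exact: cfilt_lier.
Qed.

End CompletionTheory.

(** * Weights and summability over words *)

Section Metabelian.
Context (R : realType).
Local Notation C := R[i].
Local Notation M := (pC R).
Local Notation a := (pa R).
Local Notation b := (pb R).
Implicit Types (x y z : M) (k n p q j : nat).

(* [a] has weight 1 and [b] has weight 2, so that eps_{2k} raises the weight by
   2k + 1, including for k = 0. *)
Inductive has_weight : nat -> M -> Prop :=
| weight_a : has_weight 1 a
| weight_b : has_weight 2 b
| weight_0 N : has_weight N 0
| weightD N x y : has_weight N x -> has_weight N y -> has_weight N (x + y)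
| weightZ N (c : C) x : has_weight N x -> has_weight N (c *: x)
| weight_lie N N' x y : has_weight N x -> has_weight N' y ->
    has_weight (N + N') [lie x, y].

Lemma weight_adn k N N' x y : has_weight N x -> has_weight N' y ->
  has_weight (k * N + N') (adn k x y).
Proof.
move=> hx hy; elim: k => [|k IH]; first by rewrite mul0n add0n.
by rewrite mulSn -addnA; exact: weight_lie.
Qed.

(** A bracket of weight N has at least N / 2 letters, rounded up, and the index of [lcs] is the
    number of letters minus one. *)
Lemma weight_cfilt N x : has_weight N x -> cfilt N.-1./2 x.
Proof.
elim=> {N x} [||N|N x y _ hx _ hy|N c x _ hx|N N' x y _ hx _ hy].
- exact: cfilt_any.
- exact: cfilt_any.
- exact: cfilt0.
- exact: cfiltD.
- exact: cfiltZ.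
- apply: cfilt_sub (cfilt_lie hx hy).
  lia.
Qed.

Context (eps : nat -> M -> M) (Heps : forall k, is_eps k (eps k)).

Lemma eps_derivation k : continuous_derivation (eps k).
Proof.
have e0 : eps k 0 = 0.
  have := eps_linear (Heps k) 1 0 0; rewrite !scale1r !addr0 => h.
  by apply: (addrI (eps k 0)); rewrite addr0 -h.
split; [exact: eps_linear (Heps k) | exact: eps_leibniz (Heps k) |] => n.
have /(_ 0 [set y | cfilt n (y - 0)]) := eps_continuous (Heps k).
rewrite e0 => -[|m hm]; first by exists n.
by exists m => x hx; have := hm x; rewrite /= !subr0; apply.
Qed.

Lemma weight_eps k N x : has_weight N x -> has_weight (N + (2 * k).+1) (eps k x).
Proof.
have dk := eps_derivation k.
elim=> {N x} [||N|N x y _ hx _ hy|N c x _ hx|N N' x y hx' hx hy' hy].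
- rewrite (eps_pa (Heps k)) /eps_a; case: eqP => [->|_].
    by rewrite -scaleN1r; apply/weightZ/weight_b.
  apply: weightZ; have := weight_adn (2 * k) weight_a weight_b.
  by rewrite muln1 addnC addSn addnS add1n.
- rewrite (eps_pb (Heps k)) /eps_b; case: eqP => [->|/eqP k0].
    exact: weight_0.
  apply: weightZ; apply: (big_ind (has_weight _)) => [|x y|[j jk] _] /=; [exact: weight_0 | exact: weightD |].
  apply: weightZ.
  have -> : (2 + (2 * k).+1 = (j * 1 + 2) + ((2 * k - 1 - j) * 1 + 2))%N.
    lia.
  by apply: weight_lie; apply: weight_adn; constructor.
- by rewrite (contder0 dk); exact: weight_0.
- by rewrite (contderD dk); exact: weightD.
- by rewrite (contderZ dk); exact: weightZ.
- rewrite (contder_leib dk); apply: weightD.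
    by rewrite addnAC; exact: weight_lie.
  by rewrite -addnA; exact: weight_lie.
Qed.

Definition word_weight (w : seq nat) : nat := \sum_(k <- w) (2 * k).+1.

Lemma weight_word w N x : has_weight N x ->
  has_weight (N + word_weight w) (foldr eps x w).
Proof.
move=> hx; elim: w => [|k w IH]; first by rewrite /word_weight big_nil addn0.
by rewrite /word_weight big_cons /= addnCA addnC; exact: weight_eps.
Qed.

(** Every letter weighs at least 1, the letter 0 included, so a bound on the weight bounds both the
    length and the letters. *)
Lemma light_words n : exists s : seq (seq nat),
  forall w, w \notin s -> (n <= word_weight w)%N.
Proof.
elim: n => [|n [s hs]]; first by exists [::].
exists (s ++ [::] :: [seq k :: w | k <- iota 0 n.+1, w <- s]) => -[|k w].
  by rewrite mem_cat in_cons eqxx orbT.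
rewrite mem_cat in_cons !negb_or => /and3P[_ _]; rewrite /word_weight big_cons => hw.
have [kn|nk] := leqP k n; last first.
  apply: (leq_trans nk); apply: leq_trans (leq_addr _ _).
  by rewrite leqW // leq_pmull.
have ws : w \notin s.
  apply: contra hw => ws; apply/allpairsP; exists (k, w); split=> //.
  by rewrite mem_iota add0n.
rewrite addSn ltnS; apply: leq_trans (leq_addl _ _); exact: hs.
Qed.

Lemma word_summable (c : seq nat -> C) N x : has_weight N x ->
  cfilt_summable (fun w => c w *: foldr eps x w).
Proof.
move=> hx n; have [s hs] := light_words (2 * n).+1; exists s => w /hs hw.
apply: cfiltZ; apply: cfilt_sub (weight_cfilt (weight_word w hx)).
lia.
Qed.

End Metabelian.

(** * The derivations epsilon_{2k} modulo D^2 *)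

Section ModuloD2.
Context (R : realType).
Local Notation C := R[i].
Local Notation M := (pC R).
Local Notation a := (pa R).
Local Notation b := (pb R).
Local Notation D1 := (D1 R).
Local Notation D2 := (D2 R).
Implicit Types (x y z : M) (k n p q j : nat).

Definition UV p q : M := adn p a (adn q b [lie a, b]).

Lemma D1_lie x y : D1 [lie x, y].
Proof. exact: closed_lie_gen. Qed.

Lemma D2_lie x y : D1 x -> D1 y -> D2 [lie x, y].
Proof. exact: closed_lie_gen. Qed.

Lemma D1_derivation (e : M -> M) : continuous_derivation e -> forall x, D1 x -> D1 (e x).
Proof. by move=> he; apply: closed_lie_stable. Qed.

Lemma D2_derivation (e : M -> M) : continuous_derivation e -> forall x, D2 x -> D2 (e x).
Proof. by move=> he; apply: closed_lie_stable => //; exact: D1_derivation. Qed.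

Lemma D2_lier z x : D2 x -> D2 [lie z, x].
Proof. exact: (D2_derivation (lie_derivation z)). Qed.

Lemma D1_UV p q : D1 (UV p q).
Proof.
case: p => [|p]; last exact: D1_lie.
by case: q => [|q]; exact: D1_lie.
Qed.

(** The difference is [[u, v], x] with both entries in D^1: this is why ad(a) and ad(b) act on D^1 /
    D^2 as commuting variables. *)
Lemma lie_swap_D2 u v x : D1 x -> D2 ([lie u, [lie v, x]] - [lie v, [lie u, x]]).
Proof. by move=> hx; rewrite (lie_der u) addrK; apply: D2_lie => //; exact: D1_lie. Qed.

Lemma lie_b_UV p q : D2 ([lie b, UV p q] - UV p q.+1).
Proof.
elim: p => [|p IH]; first by rewrite subrr; exact: subm0.
rewrite -(subrK [lie a, [lie b, UV p q]] [lie b, _]) -addrA.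
apply: submD; first by apply: lie_swap_D2; exact: D1_UV.
by rewrite -[UV p.+1 q.+1]/([lie a, UV p q.+1]) -lieBr; exact: D2_lier.
Qed.

Lemma UV_cfilt p q : cfilt (p + q) (UV p q).
Proof.
have cb n : cfilt n (adn n b [lie a, b]).
  by elim: n => [|n IH]; [exact: cfilt_any | exact: (cfilt_lie (cfilt_any b) IH)].
by elim: p => [|p IH]; [exact: cb | exact: (cfilt_lie (cfilt_any a) IH)].
Qed.

Definition D2n n x := exists2 y, D2 y & cfilt n (x - y).

Lemma D2n_D2 n x : D2 x -> D2n n x.
Proof. by exists x => //; rewrite subrr; exact: cfilt0. Qed.

Lemma D2n_cfilt n x : cfilt n x -> D2n n x.
Proof. by exists 0; [exact: subm0 | rewrite subr0]. Qed.

Lemma D2n0 n : D2n n 0. Proof. by apply: D2n_D2; exact: subm0. Qed.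

Lemma D2nD n x y : D2n n x -> D2n n y -> D2n n (x + y).
Proof.
move=> [u hu xu] [v hv yv]; exists (u + v); first exact: submD.
by rewrite opprD addrACA; exact: cfiltD.
Qed.

Lemma D2nZ n (c : C) x : D2n n x -> D2n n (c *: x).
Proof.
move=> [u hu xu]; exists (c *: u); first exact: submZ.
by rewrite -scalerBr; exact: cfiltZ.
Qed.

Lemma D2nN n x : D2n n x -> D2n n (- x).
Proof. by rewrite -scaleN1r; exact: D2nZ. Qed.

Lemma D2nB n x y : D2n n x -> D2n n y -> D2n n (x - y).
Proof. by move=> hx hy; apply: D2nD => //; exact: D2nN. Qed.

Lemma D2_closed x : (forall n, D2n n x) -> D2 x.
Proof.
move=> h; apply: closed_lie_closed => n; have [y hy xy] := h n.
by exists y => //; rewrite -opprB; exact: cfiltN.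
Qed.

Lemma metab_eq x y : D2 (x - y) -> metab x = metab y.
Proof. by move=> h; apply/quotm_eq. Qed.

(** The finite sets have to exhaust the families only modulo [D2n n], which is weaker than modulo
    [cfilt n]: many words land in D^2 without being deep in the filtration. *)
Lemma lim_sum_D2 (I J : choiceType) (f : I -> M) (g : J -> M) x :
  cfilt_summable f -> cfilt_summable g ->
  (forall n, exists (s : seq I) (s' : seq J), [/\ uniq s, uniq s',
    forall i, i \notin s -> D2n n (f i),
    forall j : J, j \notin s' -> D2n n (g j) &
    D2n n (\sum_(i <- s) f i - (x + \sum_(j <- s') g j))]) ->
  metab (lim (partial_sum f @ totally)) = metab (x + lim (partial_sum g @ totally)).
Proof.
move=> hf hg h; have [lf -> hlf] := summable_limit hf; have [lg -> hlg] := summable_limit hg.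
(* The set given by summability approximates the limit modulo [cfilt n], and replacing it by s
   changes the sum by terms of [D2n n]. *)
have cmp (T : choiceType) (u : T -> M) l n (s : seq T) : cfilt_summable u ->
    (forall n s, uniq s -> (forall i, i \notin s -> cfilt n (u i)) ->
      cfilt n (l - \sum_(i <- s) u i)) ->
    uniq s -> (forall i, i \notin s -> D2n n (u i)) -> D2n n (l - \sum_(i <- s) u i).
  move=> hu hl us hs; have [s0 hs0] := hu n.
  rewrite -(subrK (\sum_(i <- undup s0) u i) l) -addrA.
  apply: D2nD.
    apply: D2n_cfilt; apply: hl; first exact: undup_uniq.
    by move=> i; rewrite mem_undup; exact: hs0.
  apply: cfilt_sum_diff; rewrite ?undup_uniq //; [exact: D2n0 | exact: D2nD | exact: D2nN |].
  by move=> i; rewrite mem_undup => /hs0; exact: D2n_cfilt.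
apply/metab_eq/D2_closed => n; have [s [s' [us us' hs hs' hss]]] := h n.
have h1 := cmp _ _ _ _ _ hf hlf us hs; have h2 := cmp _ _ _ _ _ hg hlg us' hs'.
have h3 := D2nB (D2nD h1 hss) h2; move: h3.
move: (\sum_(i <- s) f i) (\sum_(j <- s') g j) => u v.
by rewrite addrA subrK -addrA -opprD -addrA (addrC v) subrK.
Qed.

Context (eps : nat -> M -> M) (Heps : forall k, is_eps k (eps k)).
Let dk k := eps_derivation Heps k.

Lemma eps0_adnb q : eps 0%N (adn q b [lie a, b]) = 0.
Proof.
elim: q => [|q IH].
  rewrite (contder_leib (dk 0)) (eps_pa (Heps 0)) (eps_pb (Heps 0)) /eps_a /eps_b eqxx.
  by rewrite lieNl liexx oppr0 lie0r addr0.
by rewrite [adn _ _ _]/= (contder_leib (dk 0)) (eps_pb (Heps 0)) /eps_b eqxx lie0l add0r [eps 0 _]IH lie0r.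
Qed.

Lemma eps0_UV p q : D2 (eps 0%N (UV p q) + p%:R *: UV p.-1 q.+1).
Proof.
elim: p => [|p IH]; first by rewrite eps0_adnb scale0r addr0; exact: subm0.
rewrite -[UV p.+1 q]/([lie a, UV p q]) (contder_leib (dk 0)) (eps_pa (Heps 0)) /eps_a eqxx lieNl.
have -> : - [lie b, UV p q] + [lie a, eps 0%N (UV p q)] + p.+1%:R *: UV p.+1.-1 q.+1 =
   [lie a, eps 0%N (UV p q) + p%:R *: UV p.-1 q.+1] - ([lie b, UV p q] - UV p q.+1).
  rewrite lieDr lieZr -natr1 scalerDl scale1r /=.
  have -> : p%:R *: [lie a, UV p.-1 q.+1] = p%:R *: UV p q.+1.
    by case: p {IH} => [|p] //; rewrite !scale0r.
  by rewrite opprB (addrC (- _)) -!addrA; congr (_ + _); rewrite addrC -addrA.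
by apply: submB; [exact: D2_lier | exact: lie_b_UV].
Qed.

(** The j-th power of - V d/dU. For j > p the falling factorial is 0, which makes the truncated
    exponent [p - j] harmless. *)
Lemma eps0_iter_UV j p q :
  D2 (iter j (eps 0%N) (UV p q) - ((-1) ^+ j * (p ^_ j)%:R) *: UV (p - j) (q + j)).
Proof.
elim: j => [|j IH].
  by rewrite expr0 mul1r ffactn0 scale1r subn0 addn0 subrr; exact: subm0.
have h1 := D2_derivation (dk 0) IH.
have h2 : D2 (((-1) ^+ j * (p ^_ j)%:R) *:
    (eps 0%N (UV (p - j) (q + j)) + (p - j)%:R *: UV (p - j).-1 (q + j).+1)).
  by apply: submZ; exact: eps0_UV.
have := submD h1 h2; congr (subm_set _ _).
rewrite (contderB (dk 0)) (contderZ (dk 0)) scalerDr addrA subrK iterS; congr (_ + _).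
rewrite scalerA ffactnSr addnS subnS natrM exprS -scaleNr; congr (_ *: _); ring.
Qed.

Lemma adn_ab j : adn j.+1 a b = UV j 0.
Proof. by rewrite /adn iterSr. Qed.

Lemma eps_a_UV k : (0 < k)%N -> eps k a = eis_coef R k *: UV (2 * k - 1) 0.
Proof.
case: k => // k _; rewrite (eps_pa (Heps _)) /eps_a -[k.+1 == 0%N]/false -adn_ab.
by rewrite (_ : (2 * k.+1 - 1).+1 = 2 * k.+1)%N //; lia.
Qed.

(** Only the summand j = 0, with entry b itself, survives; all others are brackets of two elements
    of D^1. *)
Lemma eps_b_UV k : (0 < k)%N -> D2 (eps k b - eis_coef R k *: UV (2 * k - 2) 1).
Proof.
case: k => // k _; rewrite (eps_pb (Heps _)) /eps_b -[k.+1 == 0%N]/false -scalerBr; apply: submZ.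
rewrite big_ord_recl expr0 scale1r [adn 0 a b]/= subn0 addrAC.
have -> : (2 * k.+1 - 1 = (2 * k.+1 - 2).+1)%N by lia.
rewrite adn_ab; apply: submD; first exact: lie_b_UV.
apply: (big_ind D2) => [|x y|i _]; [exact: subm0 | exact: submD |].
apply: submZ; rewrite lift0.
have -> : ((2 * k.+1 - 2).+1 - i.+1 = (2 * k.+1 - 2 - i.+1).+1)%N.
  by have := ltn_ord i; lia.
by rewrite !adn_ab; apply: D2_lie; exact: D1_UV.
Qed.

Lemma D2_D1 x : D2 x -> D1 x.
Proof.
move=> /closed_lieP h; apply/closed_lieP => n; have [u hu xu] := h n; exists u => //.
elim: hu {xu} => {u} [|u [v [w [_ _ ->]]]|u v _ hu _ hv|c u _ hu].
- exact: lspan0.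
- by apply: lspan_gen; exists v, w.
- exact: lspanD.
- exact: lspanZ.
Qed.

(** As epsilon_{2k} maps a and b into D^1, Leibniz terms that hit an outer a or b fall into D^2.
    This leaves [a, b], where - U^(2k-1) V from a and U U^(2k-2) V from b cancel. *)
Lemma eps_UV k p q : (0 < k)%N -> D2 (eps k (UV p q)).
Proof.
move=> k0; have Da : D1 (eps k a) by rewrite eps_a_UV //; apply: submZ; exact: D1_UV.
have Db : D1 (eps k b).
  rewrite -(subrK (eis_coef R k *: UV (2 * k - 2) 1) (eps k b)); apply: submD.
    by apply: D2_D1; exact: eps_b_UV.
  by apply: submZ; exact: D1_UV.
elim: p => [|p IH]; last first.
  rewrite -[UV p.+1 q]/([lie a, UV p q]) (contder_leib (dk k)); apply: submD.
    by apply: D2_lie => //; exact: D1_UV.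
  exact: D2_lier.
elim: q => [|q IH]; last first.
  rewrite -[UV 0 q.+1]/([lie b, UV 0 q]) (contder_leib (dk k)); apply: submD.
    by apply: D2_lie => //; exact: D1_UV.
  exact: D2_lier.
rewrite /UV /= (contder_leib (dk k)) eps_a_UV // lieZl (lie_antisym _ b) scalerN addrC.
have h1 : D2 (eis_coef R k *: ([lie b, UV (2 * k - 1) 0] - UV (2 * k - 1) 1)).
  by apply: submZ; exact: lie_b_UV.
have h2 := @D2_lier a _ (eps_b_UV k0).
have := submB h2 h1; congr (subm_set _ _).
rewrite lieBr lieZr scalerBr opprB addrA.
have -> : [lie a, UV (2 * k - 2) 1] = UV (2 * k - 1) 1.
  by have -> : (2 * k - 1 = (2 * k - 2).+1)%N by lia.
by rewrite subrK.
Qed.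

End ModuloD2.

(** * The finitely many words that matter below a given degree *)

Section Words.
Context (R : realType).
Local Notation C := R[i].
Local Notation M := (pC R).
Local Notation a := (pa R).
Local Notation b := (pb R).
Local Notation D2 := (D2 R).
Implicit Types (x y : M) (k n i j : nat) (w : seq nat) (p : nat * nat).
Context (eps : nat -> M -> M) (Heps : forall k, is_eps k (eps k)).
Let dk k := eps_derivation Heps k.

Lemma foldr_D2 w x : D2 x -> D2 (foldr eps x w).
Proof. by move=> hx; elim: w => [|k w IH] //=; exact: (D2_derivation (dk k)). Qed.

Lemma foldrZ w (c : C) x : foldr eps (c *: x) w = c *: foldr eps x w.
Proof. by elim: w => [|k w IH] //=; rewrite IH (contderZ (dk k)). Qed.

Lemma foldrB w x y : foldr eps (x - y) w = foldr eps x w - foldr eps y w.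
Proof. by elim: w => [|k w IH] //=; rewrite IH (contderB (dk k)). Qed.

Lemma foldr_zeros j x : foldr eps x (nseq j 0%N) = iter j (eps 0%N) x.
Proof. by elim: j => [|j IH] //=; rewrite IH. Qed.

(** The last letter acts first: the rightmost nonzero letter meets a multiple of a single monomial
    modulo D^2 and kills it, and the remaining derivations preserve D^2. *)
Lemma foldr_UV_nonzero w i j : has (predC1 0%N) w -> D2 (foldr eps (UV R i j) w).
Proof.
elim: w => [//|k w IH]; rewrite -[foldr _ _ _]/(eps k (foldr eps (UV R i j) w)) [has _ _]/=.
have [hw _|] := boolP (has (predC1 0%N) w).
  by apply: (D2_derivation (dk k)); exact: IH.
rewrite orbF has_predC negbK => /all_pred1P -> k0; rewrite foldr_zeros; rewrite -lt0n in k0.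
have h := @eps0_iter_UV R eps Heps (size w) i j.
rewrite -(subrK (((-1) ^+ size w * (i ^_ size w)%:R) *: UV R (i - size w) (j + size w)) (iter _ _ _)).
rewrite (contderD (dk k)) (contderZ (dk k)); apply: submD.
  exact: (D2_derivation (dk k)).
by apply: submZ; exact: eps_UV.
Qed.

Lemma foldr_eqD2 w x y : D2 (x - y) -> D2 (foldr eps x w - foldr eps y w).
Proof. by move=> h; rewrite -foldrB; exact: foldr_D2. Qed.

Lemma foldr_a_zeros j k : (0 < k)%N ->
  D2 (foldr eps a (rcons (nseq j 0%N) k) -
    (eis_coef R k * ((-1) ^+ j * ((2 * k - 1) ^_ j)%:R)) *: UV R (2 * k - 1 - j) j).
Proof.
move=> k0; rewrite foldr_rcons (eps_a_UV Heps) // foldrZ foldr_zeros -scalerA -scalerBr.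
by apply: submZ; have := @eps0_iter_UV R eps Heps j (2 * k - 1) 0; rewrite add0n.
Qed.

Lemma foldr_b_zeros j k : (0 < k)%N ->
  D2 (foldr eps b (rcons (nseq j 0%N) k) -
    (eis_coef R k * ((-1) ^+ j * ((2 * k - 2) ^_ j)%:R)) *: UV R (2 * k - 2 - j) j.+1).
Proof.
move=> k0; rewrite foldr_rcons.
have h1 := @foldr_eqD2 (nseq j 0%N) _ _ (eps_b_UV Heps k0).
have h2 : D2 (eis_coef R k *: (iter j (eps 0%N) (UV R (2 * k - 2) 1) -
   ((-1) ^+ j * ((2 * k - 2) ^_ j)%:R) *: UV R (2 * k - 2 - j) (1 + j))).
  by apply: submZ; exact: eps0_iter_UV.
have := submD h1 h2; congr (subm_set _ _).
by rewrite foldrZ !foldr_zeros scalerBr scalerA addrA subrK add1n.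
Qed.

Lemma foldr_a_rcons0 w : foldr eps a (rcons w 0%N) = - foldr eps b w.
Proof. by rewrite foldr_rcons (eps_pa (Heps 0)) /eps_a eqxx -scaleN1r foldrZ scaleN1r. Qed.

Lemma foldr_b_rcons0 w : foldr eps b (rcons w 0%N) = 0.
Proof.
rewrite foldr_rcons (eps_pb (Heps 0)) /eps_b eqxx.
by have := foldrZ w 0 b; rewrite !scale0r.
Qed.

Lemma foldr_a_nonzero w k : (0 < k)%N -> has (predC1 0%N) w -> D2 (foldr eps a (rcons w k)).
Proof.
by move=> k0 hw; rewrite foldr_rcons (eps_a_UV Heps) // foldrZ; apply: submZ; exact: foldr_UV_nonzero.
Qed.

Lemma foldr_b_nonzero w k : (0 < k)%N -> has (predC1 0%N) w -> D2 (foldr eps b (rcons w k)).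
Proof.
move=> k0 hw; rewrite foldr_rcons; have := @foldr_eqD2 w _ _ (eps_b_UV Heps k0).
rewrite foldrZ => h; rewrite -(subrK (eis_coef R k *: foldr eps (UV R (2 * k - 2) 1) w) (foldr _ _ w)).
by apply: submD => //; apply: submZ; exact: foldr_UV_nonzero.
Qed.

Definition box n : seq (nat * nat) := [seq (i, j) | i <- iota 0 n, j <- iota 0 n].
(** For k >= 1 the images of a and b under epsilon_{2k} have degree 2k - 1 in U and V modulo D^2,
    and epsilon_0 preserves this degree; only odd degrees occur. *)
Definition odd_box n := [seq p <- box n | odd (p.1 + p.2)].
Definition odd_box1 n := [seq p <- odd_box n | (0 < p.2)%N].

(* Words reaching the monomial U^i V^j, for p = (i, j) with i + j odd. *)
Definition word_a p := rcons (nseq p.2 0%N) (uphalf (p.1 + p.2)).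
Definition word_b p := rcons (nseq p.2.-1 0%N) (uphalf (p.1 + p.2)).
Definition word_a0 p := rcons (word_b p) 0%N.
(** The image of b already contains a factor V, hence one zero fewer in [word_b] and the restriction
    to positive powers of V. The last letter of [word_a0] first turns a into -b. *)
Definition words_b n := [::] :: map word_b (odd_box1 n).
(** The empty word and the word 0 produce the terms a and 2 pi i tau b. *)
Definition words_a n :=
  [:: [::]; [:: 0%N]] ++ map word_a (odd_box n) ++ map word_a0 (odd_box1 n).

Lemma mem_box n p : (p \in box n) = (p.1 < n)%N && (p.2 < n)%N.
Proof.
case: p => i j; apply/allpairsP/andP => /= [[[i' j']] /= [] |[hi hj]].
  by rewrite !mem_iota !add0n /= => ? ? [-> ->].
by exists (i, j); rewrite /= !mem_iota !add0n.
Qed.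

Lemma box_uniq n : uniq (box n).
Proof. by apply: allpairs_uniq; rewrite ?iota_uniq // => -[? ?] [? ?] _ _ [-> ->]. Qed.

Lemma mem_odd_box n p : (p \in odd_box n) = [&& odd (p.1 + p.2), p.1 < n & p.2 < n]%N.
Proof. by rewrite mem_filter mem_box. Qed.

Lemma mem_odd_box1 n p :
  (p \in odd_box1 n) = [&& 0 < p.2, odd (p.1 + p.2), p.1 < n & p.2 < n]%N.
Proof. by rewrite mem_filter mem_odd_box. Qed.

Lemma rcons_nseq_inj j j' k k' :
  rcons (nseq j 0%N) k = rcons (nseq j' 0%N) k' -> j = j' /\ k = k'.
Proof.
move=> h; split; last by have := congr1 (last 0%N) h; rewrite !last_rcons.
by have := congr1 size h; rewrite !size_rcons !size_nseq => -[].
Qed.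

Lemma words_b_uniq n : uniq (words_b n).
Proof.
rewrite /words_b /=; apply/andP; split.
  by apply/mapP => -[p _]; rewrite /word_b; case: (nseq _ _).
rewrite map_inj_in_uniq ?filter_uniq ?box_uniq // => -[i j] [i' j'].
rewrite !mem_odd_box1 /= => /and4P[j0 od _ _] /and4P[j0' od' _ _] /rcons_nseq_inj /= [e1 e2].
by congr pair; lia.
Qed.

Lemma words_a_uniq n : uniq (words_a n).
Proof.
rewrite /words_a cat_uniq; apply/and3P; split=> //.
  apply/hasPn => w; rewrite mem_cat => /orP[] /mapP[[i j]].
    rewrite mem_odd_box [odd _]/= => /andP[od _] hw; rewrite hw !inE negb_or /word_a.
    case: j od {hw} => [|j] od /=; last by case: (nseq j 0%N).
    by rewrite eqseq_cons andbT; lia.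
  move=> _ hw; rewrite hw /word_a0 /word_b !inE negb_or.
  by apply/andP; split; apply/eqP => /(congr1 size); rewrite !size_rcons.
rewrite cat_uniq; apply/and3P; split.
- rewrite map_inj_in_uniq ?filter_uniq ?box_uniq // => -[i j] [i' j'].
  rewrite !mem_odd_box /= => /and3P[od _ _] /and3P[od' _ _] /rcons_nseq_inj /= [e1 e2].
  by congr pair; lia.
- apply/hasPn => w /mapP[p _ ->]; apply/negP => /mapP[[i j]].
  rewrite mem_odd_box /= => /andP[od _] /(congr1 (last 0%N)).
  by rewrite /word_a0 /word_a !last_rcons /=; lia.
- have := words_b_uniq n => /andP[_]; rewrite -[map word_a0 _]/(map (rcons^~ 0%N \o word_b) _).
  by rewrite map_comp map_inj_uniq // => w w' /rcons_inj [].
Qed.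

Lemma not_words_b n w : w \notin words_b n -> D2n n (foldr eps b w).
Proof.
case/lastP: w => [//|w k]; rewrite in_cons negb_or => /andP[_ hw].
have [->|k0] := posnP k; first by rewrite foldr_b_rcons0; exact: D2n0.
have [h|] := boolP (has (predC1 0%N) w); first by apply: D2n_D2; exact: foldr_b_nonzero.
rewrite has_predC negbK => /all_pred1P ew; rewrite ew in hw *; set j := size w in hw *.
rewrite -(subrK ((eis_coef R k * ((-1) ^+ j * ((2 * k - 2) ^_ j)%:R)) *:
   UV R (2 * k - 2 - j) j.+1) (foldr _ _ _)).
apply: D2nD; first by apply: D2n_D2; exact: foldr_b_zeros.
have [jk|jk] := leqP j (2 * k - 2); last first.
  by rewrite ffact_small // !mulr0 scale0r; exact: D2n0.
apply/D2nZ/D2n_cfilt; apply: cfilt_sub (UV_cfilt R _ _).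
(* If the monomial reached had degree below n, both exponents would be below n and the word would be
   listed. *)
rewrite leqNgt; apply: contra hw => hn; apply/mapP; exists (2 * k - 2 - j, j.+1)%N.
  by rewrite mem_odd_box1 /=; lia.
by rewrite /word_b /=; congr rcons; lia.
Qed.

Lemma not_words_a n w : w \notin words_a n -> D2n n (foldr eps a w).
Proof.
case/lastP: w => [//|w k]; rewrite /words_a mem_cat [in X in _ || X]mem_cat !inE !negb_or.
move=> /andP[/andP[_ h1] /andP[h2 h3]].
have [e|k0] := posnP k.
  rewrite e foldr_a_rcons0; apply/D2nN/not_words_b; rewrite in_cons negb_or.
  apply/andP; split; first by apply/eqP => ew; move: h1; rewrite ew e eqxx.
  by apply: contra h3 => /mapP[p hp ->]; rewrite e; apply/mapP; exists p.
have [h|] := boolP (has (predC1 0%N) w); first by apply: D2n_D2; exact: foldr_a_nonzero.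
rewrite has_predC negbK => /all_pred1P ew; rewrite ew in h2 *; set j := size w in h2 *.
rewrite -(subrK ((eis_coef R k * ((-1) ^+ j * ((2 * k - 1) ^_ j)%:R)) *:
   UV R (2 * k - 1 - j) j) (foldr _ _ _)).
apply: D2nD; first by apply: D2n_D2; exact: foldr_a_zeros.
have [jk|jk] := leqP j (2 * k - 1); last first.
  by rewrite ffact_small // !mulr0 scale0r; exact: D2n0.
apply/D2nZ/D2n_cfilt; apply: cfilt_sub (UV_cfilt R _ _).
rewrite leqNgt; apply: contra h2 => hn; apply/mapP; exists (2 * k - 1 - j, j)%N.
  by rewrite mem_odd_box /=; lia.
by rewrite /word_a /=; congr rcons; lia.
Qed.

Lemma not_box n p (F : fps2 C) : p \notin box n -> cfilt n (F p.1 p.2 *: UV R p.1 p.2).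
Proof.
rewrite mem_box negb_and -!leqNgt => h; apply: cfiltZ; apply: cfilt_sub (UV_cfilt R _ _).
lia.
Qed.

Lemma fps_summable (F : fps2 C) : cfilt_summable (fun p => F p.1 p.2 *: UV R p.1 p.2).
Proof. by move=> n; exists (box n) => p; exact: not_box. Qed.

End Words.

(** * Comparison of the two sides, monomial by monomial *)

Section Coefficients.
Context (R : realType).
Local Notation C := R[i].
Local Notation M := (pC R).
Local Notation D2 := (D2 R).
Context (eps : nat -> M -> M) (Heps : forall k, is_eps k (eps k)).
Context (G : seq nat -> C -> C) (HG : iterated_eisenstein G).
Context (tau : C) (Htau : upper_half tau).
Implicit Types (i j k n : nat) (p : nat * nat).
Local Notation t := (twopii R).

Lemma eis_sum_even i j k : (i + j = 2 * k - 2)%N -> (0 < k)%N ->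
  eis_sum tau i j = eis_coef R k * (t ^+ j.+1 * ((2 * k - 2) ^_ j)%:R * Gw G j k tau).
Proof.
move=> e k0; rewrite (eis_sumE HG) // -e.
have -> : odd (i + j) = false by lia.
by have -> : ((i + j)./2.+1 = k)%N by lia.
Qed.

Lemma eis_sum_odd i j : odd (i + j) -> eis_sum tau i j = 0.
Proof. by move=> h; rewrite (eis_sumE HG) // h. Qed.

Lemma D2_scale (c d e : C) (x u : M) : D2 (x - c *: u) -> d * c = e -> D2 (d *: x - e *: u).
Proof. by move=> h <-; rewrite -scalerA -scalerBr; exact: submZ. Qed.

Lemma addr_cancel (V : zmodType) (x y z : V) : x + y - (x + z) = y - z.
Proof. by rewrite opprD addrACA subrr add0r. Qed.

Lemma add_sub_scale (V : lmodType C) (x y u : V) (c d e : C) : c + d = e ->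
  (x - c *: u) + (y - d *: u) = x + y - e *: u.
Proof. by move=> <-; rewrite scalerDl opprD addrACA. Qed.

Definition gaut_term x (w : seq nat) : M :=
  ((- t) ^+ size w * G w tau) *: foldr eps x w.

Lemma sign_sqr j : (-1) ^+ j * (-1) ^+ j = 1 :> C.
Proof. by rewrite -exprD addnn -signr_odd odd_double. Qed.

Lemma odd_boxP n p : p \in odd_box n -> exists k,
  [/\ (0 < k)%N, uphalf (p.1 + p.2) = k & (p.1 + p.2 = 2 * k - 1)%N].
Proof.
rewrite mem_odd_box => /and3P[od _ _]; exists (uphalf (p.1 + p.2)).
by move: (p.1 + p.2)%N od => m od; split; lia.
Qed.

(** The word has length j + 1, and the sign of (-2 pi i)^(j+1) against the (-1)^j of the j zeros
    leaves one global minus sign. *)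
Lemma gaut_term_b n p : p \in odd_box1 n ->
  D2 (gaut_term (t *: pb R) (word_b p) -
    (- (t *: (fpsV C * eis_sum tau))) p.1 p.2 *: UV R p.1 p.2).
Proof.
case: p => i [|j]; first by rewrite mem_odd_box1.
rewrite mem_filter => /andP[_] /odd_boxP [k] /= [k0 ek e2].
rewrite /word_b /= ek /gaut_term (foldrZ Heps) scalerA size_rcons size_nseq.
have e3 : (2 * k - 2 - j = i)%N by lia.
have h := @foldr_b_zeros R eps Heps j k k0; rewrite e3 in h; apply: D2_scale h _.
rewrite fpsNE fpsZE fpsVM (eis_sum_even (k := k)) //; last by lia.
rewrite -cats1 -/(Gw G j k) (exprNn t) (exprS (-1)).
have := sign_sqr j; move: ((-1) ^+ j : C) (t ^+ j.+1) => s u ss.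
have -> (x y z w : C) : -1 * s * u * x * y * (z * (s * w)) = (s * s) * - (y * (z * (u * w * x))) by ring.
by rewrite ss mul1r.
Qed.

(** For a positive power of V two words reach the same monomial, and only their sum matches the
    coefficient of W times the Eisenstein sum. *)
Lemma gaut_term_a n p : p \in odd_box n ->
  D2 (gaut_term (pa R) (word_a p) +
      (if (0 < p.2)%N then gaut_term (pa R) (word_a0 p) else 0) -
    (- (t *: (Wser tau * eis_sum tau))) p.1 p.2 *: UV R p.1 p.2).
Proof.
case: p => i j /odd_boxP [k] /= [k0 ek e2]; rewrite fpsNE fpsZE WserM.
(* For i = 0 one has j = 2k - 1 > 2k - 2, so the falling factorial vanishes and one formula covers
   both cases. *)
have e1 : (if i is i'.+1 then eis_sum tau i' j else 0) =
    eis_coef R k * (t ^+ j.+1 * ((2 * k - 2) ^_ j)%:R * Gw G j k tau).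
  case: i e2 {ek} => [|i] e2; last by apply: eis_sum_even => //; lia.
  by rewrite ffact_small ?mulr0 ?mul0r ?mulr0 //; lia.
rewrite e1 /word_a /word_a0 /word_b /= ek.
have ha := @foldr_a_zeros R eps Heps j k k0.
have ei : (2 * k - 1 - j = i)%N by lia.
rewrite ei in ha.
have t0 := twopii_neq0 R.
case: j e2 e1 ek ha ei => [|j] e2 e1 ek ha ei /=.
  rewrite addr0 /gaut_term; apply: D2_scale ha _.
  by rewrite /= !ffactn0 expr0 !expr1 /Gw /=; field.
have hb := @foldr_b_zeros R eps Heps j k k0.
have ej : (2 * k - 2 - j = i)%N by lia.
rewrite ej in hb.
rewrite (eis_sum_even (k := k)) //; last by lia.
pose u1 := (- t) ^+ j.+2 * Gw G j.+1 k tau.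
pose u2 := (- t) ^+ j.+2 * (tau * Gw G j k tau - j.+1%:R * Gw G j.+1 k tau).
have -> : gaut_term (pa R) (rcons (0%N :: nseq j 0%N) k) =
    u1 *: foldr eps (pa R) (rcons (nseq j.+1 0%N) k).
  by rewrite /gaut_term /u1 /Gw /= size_rcons size_nseq cats1.
have -> : gaut_term (pa R) (rcons (rcons (nseq j 0%N) k) 0%N) =
    - u2 *: foldr eps (pb R) (rcons (nseq j 0%N) k).
  rewrite /gaut_term (foldr_a_rcons0 Heps) !size_rcons size_nseq scalerN scaleNr.
  by rewrite -cats1 -(cats1 _ k) -catA (G_0k0 HG).
have h1 := D2_scale ha (erefl (u1 * _)); have h2 := D2_scale hb (erefl (- u2 * _)).
have := submD h1 h2; congr (subm_set _ _).
apply: add_sub_scale; rewrite /u1 /u2.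
have -> : (2 * k - 1 = (2 * k - 2).+1)%N by lia.
rewrite ffactSS.
(* The last summand cancels the term (j+1) G(0^(j+1), 2k) of the shuffle relation. What remains is
   the U / (2 pi i) part of W, while tau G(0^j, 2k) gives the tau V part. *)
have ff : ((2 * k - 2).+1 * (2 * k - 2) ^_ j =
    (2 * k - 2) ^_ j.+1 + j.+1 * (2 * k - 2) ^_ j)%N.
  rewrite ffactnSr [X in (X + _)%N]mulnC -mulnDl.
  have [jk|jk] := leqP j (2 * k - 2); last by rewrite ffact_small // !muln0.
  by congr (_ * _)%N; lia.
rewrite ff natrD natrM (exprNn t) (exprS (-1) j.+1) !(exprS (-1) j) !(exprS t).
have := sign_sqr j; move: ((-1) ^+ j : C) (t ^+ j) => s u ss.
move: (Gw G j.+1 k tau) (Gw G j k tau) (eis_coef R k) => g1 g0 c.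
move: (((2 * k - 2) ^_ j.+1)%:R : C) (((2 * k - 2) ^_ j)%:R : C) (j.+1%:R : C) => f1 f0 m.
(* Here s is (-1)^j; inserting s^2 = 1 on the right makes both sides the same rational
   expression. *)
have key (r : C) : r = s * s * r by rewrite ss mul1r.
rewrite [RHS]key; field.
exact: t0.
Qed.

Lemma metab_gaut_b : metab (gaut eps G tau (t *: pb R)) =
  metab_of 0 t (- (t *: (fpsV C * eis_sum tau))).
Proof.
set F := - _; rewrite /gaut /metab_of scale0r add0r.
apply: lim_sum_D2.
- have := word_summable Heps (fun w => (- t) ^+ size w * G w tau) (weightZ t (weight_b R)).
  exact.
- exact: fps_summable.
move=> n; exists (words_b n), (box n); split.
- exact: words_b_uniq.
- exact: box_uniq.
- by move=> w hw; apply: D2nZ; rewrite (foldrZ Heps); apply: D2nZ; exact: not_words_b.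
- by move=> p hp; apply: D2n_cfilt; exact: not_box.
rewrite big_cons big_map /= expr0 mul1r (iterated_nil HG Htau) scale1r addr_cancel.
have -> : \sum_(p <- box n) F p.1 p.2 *: adn p.1 (pa R) (adn p.2 (pb R) [lie pa R, pb R]) =
    \sum_(p <- odd_box1 n) F p.1 p.2 *: UV R p.1 p.2.
  rewrite !big_filter_cond big_mkcond [RHS]big_mkcond /=; apply: eq_bigr => -[i j] _ /=.
  case: ifP => // /negbT h; rewrite /F fpsNE fpsZE fpsVM.
  case: j h => [|j] h; first by rewrite mulr0 oppr0 scale0r.
  rewrite eis_sum_odd ?mulr0 ?oppr0 ?scale0r //; move: h; rewrite andbT addnS /=; lia.
rewrite -sumrB big_seq; apply: (big_ind (D2n n)); [exact: D2n0 | exact: D2nD |].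
by move=> p hp; apply: D2n_D2; exact: (gaut_term_b hp).
Qed.

Lemma metab_gaut_a : metab (gaut eps G tau (pa R)) =
  metab_of 1 (t * tau) (- (t *: (Wser tau * eis_sum tau))).
Proof.
set F := - _; rewrite /gaut /metab_of scale1r.
apply: lim_sum_D2.
- have := word_summable Heps (fun w => (- t) ^+ size w * G w tau) (weight_a R).
  exact.
- exact: fps_summable.
move=> n; exists (words_a n), (box n); split.
- exact: words_a_uniq.
- exact: box_uniq.
- by move=> w hw; apply: D2nZ; exact: not_words_a.
- by move=> p hp; apply: D2n_cfilt; exact: not_box.
rewrite big_cat /= big_cons big_seq1 big_cat !big_map /= expr0 expr1 mul1r.
rewrite (iterated_nil HG Htau) scale1r (G_0 HG Htau) (eps_pa (Heps 0)) /eps_a eqxx.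
rewrite scalerN mulNr scaleNr opprK addr_cancel.
have -> : \sum_(p <- box n) F p.1 p.2 *: adn p.1 (pa R) (adn p.2 (pb R) [lie pa R, pb R]) =
    \sum_(p <- odd_box n) F p.1 p.2 *: UV R p.1 p.2.
  rewrite big_filter big_mkcond [RHS]big_mkcond /=; apply: eq_bigr => -[i j] _ /=.
  case: ifP => // /negbT h; rewrite /F fpsNE fpsZE WserM.
  have -> : (if i is i'.+1 then eis_sum tau i' j else 0) = 0.
    by case: i h => // i h; rewrite eis_sum_odd //; move: h; rewrite addSn /= negbK.
  have -> : (if j is j'.+1 then eis_sum tau i j' else 0) = 0.
    by case: j h => // j h; rewrite eis_sum_odd //; move: h; rewrite addnS /= negbK.
  by rewrite !mulr0 addr0 mulr0 oppr0 scale0r.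
(* Both families of words are summed over [odd_box n], with 0 where V is absent, so that the two
   words of a monomial are paired. *)
rewrite [X in _ + X - _]big_filter [X in _ + X - _]big_mkcond -big_split -sumrB big_seq.
apply: (big_ind (D2n n)); [exact: D2n0 | exact: D2nD |].
by move=> p hp; apply: D2n_D2; exact: (gaut_term_a hp).
Qed.

End Coefficients.
Theorem theorem5p4 (R : realType)
    (eps : nat -> pC R -> pC R) (Heps : forall k, is_eps k (eps k))
    (Gint : seq nat -> R[i] -> R[i]) (HG : iterated_eisenstein Gint)
    (tau : R[i]) (Htau : 0 < complex.Im tau) :
  metab (gaut eps Gint tau (pa R)) =
    metab_of 1 (twopii R * tau)
      (- (twopii R *: (Wser tau * eis_sum tau))) /\
  metab (gaut eps Gint tau (twopii R *: pb R)) =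
    metab_of 0 (twopii R)
      (- (twopii R *: (fpsV _ * eis_sum tau))).
Proof. by split; [exact: metab_gaut_a | exact: metab_gaut_b]. Qed.
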